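(* Let $(x^k)_k$ be generated by Algorithm S4N (described in the context) and suppose that the following hold: (A.1) $\nabla f$ is Lipschitz continuous on $\mathbb{R}^n$ with modulus $L>0$; (A.2) $\psi$ is bounded from below on $\mathrm{dom}\, r$; (B.1) there are $0<\lambda_m\le\lambda_M<\infty$ with $\lambda_M I\succeq\Lambda_k\succeq\lambda_m I$ for all $k$; (B.2) $(\nu_k)_k,(\varepsilon^2_k)_k\in\ell^1_+$ and $(\varepsilon^1_k)_k\in\ell^p_+$ (with $p$ the algorithm parameter); (C.1) for every $k$, $M_k$ is an $\mathcal F_k$-measurable selection of the multifunction $\omega\mapsto\mathcal M^{\Lambda_k}_{s^k(\omega),t^k(\omega)}(x^k(\omega))$; (C.2) for every $k$ there is $\sigma_k\ge0$ with $\mathbb E[\|\nabla f(x^k)-G_{s^k}(x^k)\|^2]\le\sigma_k^2$. Suppose further that the step sizes $\alpha_k\in[0,1]$ are such that, for some fixed $\gamma\in(0,1)$ and $\rho\in(1,\gamma^{-1})$ and with $v^k:=-F^{\Lambda_k}_{s^k}(x^k)$, $$\psi(x^k+\alpha_k v^k)-\psi(x^k)\le-\alpha_k\gamma\|v^k\|_{\Lambda_k}^2+\frac{\alpha_k}{4\gamma(\rho-1)\lambda_m}\|\nabla f(x^k)-G_{s^k}(x^k)\|^2\quad\text{for all }k,$$ and that $(\alpha_k)_k$ is monotonically decreasing with $\sum_k\alpha_k=\infty$ and $\sum_k\alpha_k\sigma_k^2<\infty$. Then for every $\Lambda\in\mathbb S^n_{++}$ it holds $\liminf_{k\to\infty}\mathbb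 E[\|F^\Lambda(x^k)\|^2]=0$ and $\liminf_{k\to\infty}\|F^\Lambda(x^k)\|=0$ almost surely.
   Context: Setting: $f:\mathbb{R}^n\to\mathbb{R}$ is continuously differentiable, $r:\mathbb{R}^n\to(-\infty,+\infty]$ is convex, lower semicontinuous and proper, and $\psi:=f+r$. $\mathbb S^n$ ($\mathbb S^n_{++}$) denotes symmetric (symmetric positive definite) $n\times n$ matrices. For $\Lambda\in\mathbb S^n_{++}$: $\|x\|_\Lambda:=\sqrt{\langle x,\Lambda x\rangle}$, $\mathrm{prox}^\Lambda_r(x):=\arg\min_y\, r(y)+\tfrac12\|x-y\|_\Lambda^2$, $u^\Lambda(x):=x-\Lambda^{-1}\nabla f(x)$, $F^\Lambda(x):=x-\mathrm{prox}^\Lambda_r(u^\Lambda(x))$. A point $x$ with $F^\Lambda(x)=0$ is called stationary. Stochastic setup: $(\Omega,\mathcal F,\mathbb P)$ is a probability space, $(\Xi,\mathcal X)$ a measurable space, and $\mathcal G:\mathbb{R}^n\times\Xi\to\mathbb{R}^n$, $\mathcal H:\mathbb{R}^n\times\Xi\to\mathbb S^n$ are Carathéodory functions (continuous in $x$, measurable in the second argument). For a mini-batch $s=(s_1,\dots,s_m)$ of measurable maps $s_i:\Omega\to\Xi$ set $G_s(x):=\frac1m\sum_{i=1}^m\mathcal G(x,s_i)$, similarly $H_t(x):=\frac1{m'}\sum_{j=1}^{m'}\mathcal H(x,t_j)$ for $t=(t_1,\dots,t_{m'})$. Put $u^\Lambda_s(x):=x-\Lambda^{-1}G_s(x)$,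 $F^\Lambda_s(x):=x-\mathrm{prox}^\Lambda_r(u^\Lambda_s(x))$, and $\mathcal M^\Lambda_{s,t}(x):=\{(I-D)+D\Lambda^{-1}H_t(x): D\in\partial\mathrm{prox}^\Lambda_r(u^\Lambda_s(x))\}$, where $\partial$ denotes the Clarke generalized Jacobian. Algorithm S4N: given $x^0\in\mathrm{dom}\,r$, $\theta_0\ge0$, deterministic matrices $(\Lambda_k)_k\subset\mathbb S^n_{++}$, step sizes $(\alpha_k)_k$, constants $\eta,p\in(0,1)$, $\beta>0$, nonnegative sequences $(\nu_k),(\varepsilon^1_k),(\varepsilon^2_k)$, sample sizes $\mathbf n^g_k,\mathbf n^h_k$ and mini-batches $s^k=(s^k_1,\dots,s^k_{\mathbf n^g_k})$, $t^k=(t^k_1,\dots,t^k_{\mathbf n^h_k})$ of random samples. At iteration $k$: choose $M_k\in\mathcal M^{\Lambda_k}_{s^k,t^k}(x^k)$, set $d^k:=-M_k^+F^{\Lambda_k}_{s^k}(x^k)$ ($M^+$ the Moore–Penrose inverse; i.e. $d^k$ solves $M_kd^k=-F^{\Lambda_k}_{s^k}(x^k)$), $z^k_{\mathsf n}:=x^k+d^k$ and $z^k_{\mathsf p}:=x^k-\alpha_kF^{\Lambda_k}_{s^k}(x^k)$. If $z^k_{\mathsf n}\in\mathrm{dom}\,r$ and both (G1) $\|F^{\Lambda_{k+1}}_{s^{k+1}}(z^k_{\mathsf n})\|\le(\eta+\nu_k)\theta_k+\varepsilon^1_k$ and (G2) $\psi(z^k_{\mathsf n})\le\psi(x^k)+\beta\theta_k^{1-p}\|F^{\Lambda_{k+1}}_{s^{k+1}}(z^k_{\mathsf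 n})\|^p+\varepsilon^2_k$ hold, set $x^{k+1}:=z^k_{\mathsf n}$, $\theta_{k+1}:=\|F^{\Lambda_{k+1}}_{s^{k+1}}(z^k_{\mathsf n})\|$; otherwise set $x^{k+1}:=z^k_{\mathsf p}$, $\theta_{k+1}:=\theta_k$. Filtrations: $\mathcal F_k:=\sigma(s^0,\dots,s^k,t^0,\dots,t^k)$, $\hat{\mathcal F}_k:=\sigma(s^0,\dots,s^{k+1},t^0,\dots,t^k)$. *)

(* Defs.v *)
From HB Require Import structures.
From mathcomp Require Import all_boot all_order all_algebra.
From mathcomp Require Import all_classical all_reals all_analysis.
Set Implicit Arguments. Unset Strict Implicit. Unset Printing Implicit Defensive.
Import Order.TTheory GRing.Theory Num.Def Num.Theory.
Import numFieldNormedType.Exports.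
Local Open Scope classical_set_scope.
Local Open Scope ring_scope.

Section S4N.
Context {R : realType} {n : nat}.
Local Notation vec := 'cV[R]_n.
Local Notation mat := 'M[R]_n.

Definition dotv (x y : vec) : R := \sum_(i < n) x i 0 * y i 0.
Definition enorm (x : vec) : R := Num.sqrt (dotv x x).
Definition lnorm (L : mat) (x : vec) : R := Num.sqrt (dotv x (L *m x)).

Definition is_spd (L : mat) : Prop :=
  L^T = L /\ forall x : vec, x != 0 -> 0 < dotv x (L *m x).
Definition loewner_le (A B : mat) : Prop :=
  forall x : vec, dotv x (A *m x) <= dotv x (B *m x).

Definition is_gradient (f : vec -> R) (gradf : vec -> vec) : Prop :=
  forall x, differentiable f x /\ forall v, 'd f x v = dotv (gradf x) v.

Definition edom (r : vec -> \bar R) : set vec := [set x | (r x < +oo)%E].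
Definition proper_fun (r : vec -> \bar R) : Prop :=
  (forall x, r x != -oo%E) /\ (exists x, (r x < +oo)%E).
Definition econvex (r : vec -> \bar R) : Prop :=
  forall (x y : vec) (t : R), 0 <= t <= 1 ->
    (r (t *: x + (1 - t) *: y)%R <= t%:E * r x + (1 - t)%:E * r y)%E.

Definition psi (f : vec -> R) (r : vec -> \bar R) (x : vec) : \bar R :=
  ((f x)%:E + r x)%E.

Definition prox (L : mat) (r : vec -> \bar R) (x : vec) : vec :=
  xget 0 [set y | forall z : vec,
    (r y + (2^-1 * lnorm L (x - y) ^+ 2)%:E <= r z + (2^-1 * lnorm L (x - z) ^+ 2)%:E)%E].

(** u^Lambda_g(x) = x - Lambda^{-1} g  and  F^Lambda_g(x) = x - prox(u), where g is
    either grad f(x) (giving u^Lambda, F^Lambda) or G_s(x) (giving u^Lambda_s, F^Lambda_s). *)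
Definition uL (L : mat) (g : vec) (x : vec) : vec := x - invmx L *m g.
Definition FL (L : mat) (r : vec -> \bar R) (g : vec) (x : vec) : vec :=
  x - prox L r (uL L g x).

Definition jacobian_at (F : vec -> vec) (x : vec) (J : mat) : Prop :=
  differentiable F x /\ forall v : vec, 'd F x v = J *m v.
Definition bouligand_jac (F : vec -> vec) (x : vec) : set mat :=
  [set J | exists (xs : nat -> vec) (Js : nat -> mat),
     (forall k, jacobian_at F (xs k) (Js k)) /\ xs @ \oo --> x /\ Js @ \oo --> J].
Definition clarke_jac (F : vec -> vec) (x : vec) : set mat :=
  [set J | exists (m : nat) (w : 'I_m -> R) (V : 'I_m -> mat),
     (forall i, 0 <= w i) /\ \sum_(i < m) w i = 1 /\
     (forall i, bouligand_jac F x (V i)) /\ J = \sum_(i < m) w i *: V i].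

Definition mpinv (M : mat) : mat :=
  xget 0 [set X : mat | M *m X *m M = M /\ X *m M *m X = X /\
                        (M *m X)^T = M *m X /\ (X *m M)^T = X *m M].

Definition Gavg {Xi : Type} (Gc : vec -> Xi -> vec) (m : nat) (s : 'I_m -> Xi) (x : vec) : vec :=
  m%:R^-1 *: \sum_(i < m) Gc x (s i).
Definition Havg {Xi : Type} (Hc : vec -> Xi -> mat) (m : nat) (s : 'I_m -> Xi) (x : vec) : mat :=
  m%:R^-1 *: \sum_(i < m) Hc x (s i).

(** M^Lambda_{s,t}(x), given g = G_s(x) and H = H_t(x) *)
Definition Mset (L : mat) (r : vec -> \bar R) (g : vec) (H : mat) (x : vec) : set mat :=
  [set (1%:M - D) + D *m invmx L *m H | D in clarke_jac (prox L r) (uL L g x)].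

End S4N.

Definition filtr {d dX} {T : measurableType d} {Xi : measurableType dX}
  (ng nh : nat -> nat) (s : forall k, 'I_(ng k) -> T -> Xi) (t : forall k, 'I_(nh k) -> T -> Xi)
  (k : nat) : set (set T) :=
  <<s [set A | exists j, (j <= k)%N /\
        ((exists i (B : set Xi), measurable B /\ A = s j i @^-1` B) \/
         (exists i (B : set Xi), measurable B /\ A = t j i @^-1` B))] >>.

(* Main.v *)
(** Fix a sample path. Accepted steps contract [theta] up to summable errors, so that
    the sums over accepted steps of [theta_(k+1)^2] and of the increments
    [theta_k^(1-p) theta_(k+1)^p] allowed in (G2) have bounds independent of the path.
    Rejected steps decrease [psi] by a multiple of [alpha_k |F^k|^2], up to
    [alpha_k |grad f(x^k) - G^k|^2]. The residual at [x^(k+1)] is comparable to [theta_(k+1)]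
    after an accepted step and to [|F^k|] after a rejected one, up to gradient errors,
    for any choice of metrics; as [alpha] decreases, this yields
    [sum alpha_k |F(x^k)|^2 <= C1 + C2 sum alpha_k |grad f(x^k) - G^k|^2]
    with deterministic [C1] and [C2]. Taking expectations, respectively using that the
    right-hand side is almost surely finite, and [sum alpha_k = oo] give both claims. *)

(* Which steps are accepted is random, so no constant may depend on the pattern of acceptance. The
   estimates are therefore proved for real sequences with an arbitrary boolean pattern, and their
   constants are fixed before the pattern is given. The recursion for [theta] is raised to the power
   [p]: ([eps1]) is summable only after that, (G2) also involves [theta_(k+1)^p], and [t^p] is
   subadditive for [p < 1]. A uniform bound on [theta] then converts sums of [theta^p] into the two
   sums required. Residuals in different metrics are comparable because [Lambda (u - prox u)] is a
   subgradient of [r] at [prox u] whatever the metric, and subgradients of one convex function are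
   monotone. Expectations require measurable iterates. The data enter through Caratheodory maps,
   [prox] is continuous and [psi] is lower semicontinuous; the obstacle is the pseudo-inverse, which
   jumps where the rank changes. It is reached as a pointwise limit of regularised inverses. *)
Require Import Defs.
From mathcomp Require Import all_boot all_order all_algebra.
From mathcomp Require Import all_classical all_reals all_analysis measurable_realfun.
From mathcomp Require Import ring lra.
Import Order.TTheory GRing.Theory Num.Def Num.Theory.
Import numFieldNormedType.Exports.
Set Implicit Arguments. Unset Strict Implicit. Unset Printing Implicit Defensive.
Local Open Scope classical_set_scope.
Local Open Scope ring_scope.

(** * Euclidean geometry *)

Section Euclidean.
Context {R : realType} {n : nat}.
Implicit Types (x y z : 'cV[R]_n) (A L : 'M[R]_n).

Lemma dotvE x y : dotv x y = (x^T *m y) 0 0.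
Proof. by rewrite /dotv mxE; apply: eq_bigr => i _; rewrite mxE. Qed.

Lemma dotvC x y : dotv x y = dotv y x.
Proof. by apply: eq_bigr => i _; rewrite mulrC. Qed.

Lemma dotvDr x y z : dotv x (y + z) = dotv x y + dotv x z.
Proof. by rewrite !dotvE mulmxDr mxE. Qed.

Lemma dotvDl x y z : dotv (y + z) x = dotv y x + dotv z x.
Proof. by rewrite !(dotvC _ x) dotvDr. Qed.

Lemma dotvNr x y : dotv x (- y) = - dotv x y.
Proof. by rewrite !dotvE mulmxN mxE. Qed.

Lemma dotvNl x y : dotv (- y) x = - dotv y x.
Proof. by rewrite !(dotvC _ x) dotvNr. Qed.

Lemma dotvBr x y z : dotv x (y - z) = dotv x y - dotv x z.
Proof. by rewrite dotvDr dotvNr. Qed.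

Lemma dotvBl x y z : dotv (y - z) x = dotv y x - dotv z x.
Proof. by rewrite dotvDl dotvNl. Qed.

Lemma dotvZr a x y : dotv x (a *: y) = a * dotv x y.
Proof. by rewrite !dotvE -scalemxAr mxE. Qed.

Lemma dotvZl a x y : dotv (a *: y) x = a * dotv y x.
Proof. by rewrite !(dotvC _ x) dotvZr. Qed.

Lemma dotv0r x : dotv x 0 = 0.
Proof. by rewrite dotvE mulmx0 mxE. Qed.

Lemma dotv0l x : dotv 0 x = 0.
Proof. by rewrite dotvC dotv0r. Qed.

Lemma dotv_tr A x y : dotv x (A *m y) = dotv (A^T *m x) y.
Proof. by rewrite !dotvE trmx_mul trmxK mulmxA. Qed.

Lemma dotv_symC A x y : A^T = A -> dotv x (A *m y) = dotv y (A *m x).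
Proof. by move=> sA; rewrite dotv_tr sA dotvC. Qed.

Lemma dotv_scalar a x y : dotv x (a%:M *m y) = a * dotv x y.
Proof. by rewrite mul_scalar_mx dotvZr. Qed.

Lemma dotv_ge0 x : 0 <= dotv x x.
Proof. by apply: sumr_ge0 => i _; rewrite -expr2 sqr_ge0. Qed.

Lemma dotv_eq0 x : dotv x x = 0 -> x = 0.
Proof.
move=> /eqP; rewrite psumr_eq0 => [/allP xx|i _]; last by rewrite -expr2 sqr_ge0.
apply/colP => i; rewrite mxE; apply/eqP; rewrite -sqrf_eq0 expr2.
by apply: (xx i); rewrite mem_index_enum.
Qed.

Lemma psd_cauchy_schwarz A x y : A^T = A -> (forall z, 0 <= dotv z (A *m z)) ->
  dotv x (A *m y) ^+ 2 <= dotv x (A *m x) * dotv y (A *m y).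
Proof.
move=> sA pA.
have Q t s : 0 <= t ^+ 2 * dotv x (A *m x) + 2 * t * s * dotv x (A *m y)
    + s ^+ 2 * dotv y (A *m y).
  have := pA (t *: x + s *: y).
  rewrite mulmxDr -!scalemxAr !(dotvDl, dotvDr, dotvZl, dotvZr).
  by rewrite (dotv_symC y x sA) => /le_trans; apply; lra.
move: (pA x) (pA y) Q.
set a := dotv x (A *m x); set b := dotv x (A *m y); set c := dotv y (A *m y).
(* The pair [(c, -b)] gives [c (a c - b^2) >= 0], which is void for [c = 0]; there [(-b, a + 1)]
   gives [-(a + 2) b^2 >= 0], hence [b = 0]. *)
move=> a0 c0 Q; have [c_gt0|c_le0] := ltP 0 c.
  by have := Q c (- b); nra.
have {c_le0}c0' : c = 0 by apply/eqP; rewrite eq_le c_le0.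
have := Q (- b) (a + 1); rewrite c0' mulr0; nra.
Qed.

Lemma enorm_ge0 x : 0 <= enorm x.
Proof. exact: sqrtr_ge0. Qed.

Lemma enorm_sqr x : enorm x ^+ 2 = dotv x x.
Proof. by rewrite sqr_sqrtr // dotv_ge0. Qed.

Lemma cauchy_schwarz x y : `|dotv x y| <= enorm x * enorm y.
Proof.
rewrite -ler_sqr ?nnegrE ?mulr_ge0 ?enorm_ge0 // real_normK ?num_real //.
rewrite exprMn !enorm_sqr.
have := @psd_cauchy_schwarz 1%:M x y (trmx1 _ _).
by rewrite !mul1mx; apply => z; rewrite mul1mx dotv_ge0.
Qed.

Lemma dotv_le x y : dotv x y <= enorm x * enorm y.
Proof. exact: le_trans (ler_norm _) (cauchy_schwarz _ _). Qed.

Lemma enorm0 : enorm (0 : 'cV[R]_n) = 0.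
Proof. by rewrite /enorm dotv0r sqrtr0. Qed.

Lemma enormN x : enorm (- x) = enorm x.
Proof. by rewrite /enorm dotvNl dotvNr opprK. Qed.

Lemma enormZ a x : enorm (a *: x) = `|a| * enorm x.
Proof.
by rewrite /enorm dotvZl dotvZr mulrA -expr2 sqrtrM ?sqr_ge0 // sqrtr_sqr.
Qed.

Lemma enormD x y : enorm (x + y) <= enorm x + enorm y.
Proof.
rewrite -ler_sqr ?nnegrE ?addr_ge0 ?enorm_ge0 //.
rewrite enorm_sqr !(dotvDl, dotvDr) sqrrD !enorm_sqr (dotvC y x).
by have := dotv_le x y; lra.
Qed.

Lemma enormB x y : enorm (x - y) <= enorm x + enorm y.
Proof. by rewrite (le_trans (enormD _ _)) // enormN. Qed.

Lemma enorm_coord x i : `|x i 0| <= enorm x.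
Proof.
rewrite -ler_sqr ?nnegrE ?enorm_ge0 // real_normK ?num_real // enorm_sqr.
rewrite /dotv (bigD1 i) //= -expr2 lerDl.
by apply: sumr_ge0 => j _; rewrite -expr2 sqr_ge0.
Qed.

Lemma norm_dotv_mx_le A x y :
  `|dotv x (A *m y)| <= (\sum_i \sum_j `|A i j|) * (enorm x * enorm y).
Proof.
rewrite /dotv (le_trans (ler_norm_sum _ _ _)) // mulr_suml.
apply: ler_sum => i _; rewrite mxE mulr_sumr mulr_suml.
rewrite (le_trans (ler_norm_sum _ _ _)) //.
apply: ler_sum => j _; rewrite !normrM mulrCA ler_wpM2l //.
by rewrite ler_pM // enorm_coord.
Qed.

(** Explicit bounds stand in for eigenvalues. All [Lambda_k] share one pair [(lo, hi)], so estimates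
    expressed through it are uniform in [k]. *)
Definition quad_bounds L (lo hi : R) : Prop :=
  [/\ L^T = L, 0 < lo, forall x, lo * dotv x x <= dotv x (L *m x)
   & forall x, dotv x (L *m x) <= hi * dotv x x].

Lemma spd_unitmx L : is_spd L -> L \in unitmx.
Proof.
move=> [sL pL]; rewrite -row_free_unit -kermx_eq0; apply/eqP/row_matrixP => i.
rewrite row0; set u := row i _.
have uL0 : u *m L = 0 by rewrite /u -row_mul mulmx_ker row0.
apply/eqP; apply: contraT => u0.
have := pL u^T; rewrite dotvE trmxK mulmxA uL0 mul0mx mxE ltxx.
by rewrite trmx_eq0 u0 => /(_ isT).
Qed.

Lemma quad_bounds_spd L lo hi : quad_bounds L lo hi -> is_spd L.
Proof.
move=> [sL lo0 Llo _]; split=> // x x0; apply: lt_le_trans (Llo x).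
by rewrite mulr_gt0 // lt_def dotv_ge0 andbT; apply: contra_neq x0 => /dotv_eq0.
Qed.

Lemma loewner_quad_bounds L lo hi : is_spd L -> 0 < lo ->
  loewner_le lo%:M L -> loewner_le L hi%:M -> quad_bounds L lo hi.
Proof.
move=> [sL _] lo0 Llo Lhi; split => // x.
- by rewrite -dotv_scalar Llo.
- by rewrite -dotv_scalar Lhi.
Qed.

(* Cauchy-Schwarz in the inner product of [L], applied to [L^-1 x] and [x],
   bounds the smallest eigenvalue below without a compactness argument. *)
Lemma spd_quad_bounds L : is_spd L -> exists lo hi, quad_bounds L lo hi.
Proof.
move=> spdL; have [sL pL] := spdL; have uL := spd_unitmx spdL.
have pL0 z : 0 <= dotv z (L *m z).
  have [->|/pL/ltW//] := eqVneq z 0; first by rewrite mulmx0 dotv0r.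
(* The summand 1 keeps [K] positive even in dimension zero, where the sum is empty. *)
pose K := 1 + \sum_i \sum_j `|invmx L i j|.
have K0 : 0 < K by rewrite ltr_pwDl // sumr_ge0 // => i _; rewrite sumr_ge0.
exists K^-1, (\sum_i \sum_j `|L i j|); split => //; first by rewrite invr_gt0.
  move=> x; rewrite mulrC ler_pdivrMr //.
  have := psd_cauchy_schwarz (invmx L *m x) x sL pL0.
  rewrite (dotv_symC _ _ sL) mulmxA mulmxV // mul1mx.
  have := norm_dotv_mx_le (invmx L) x x.
  rewrite -expr2 enorm_sqr dotvC => /(le_trans (ler_norm _)) h1.
  have {}h1 : dotv (invmx L *m x) x <= K * dotv x x.
    by rewrite (le_trans h1) // ler_wpM2r ?dotv_ge0 // /K lerDr.
  have := pL0 x; have := dotv_ge0 x; move: h1.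
  set a := dotv x x; set b := dotv _ x; set c := dotv x _ => h1 a0 c0 h2.
  have [->|a_neq0] := eqVneq a 0; first by rewrite mulr_ge0 // ltW.
  have a_gt0 : 0 < a by rewrite lt_def a_neq0.
  by rewrite -(ler_pM2l a_gt0); nra.
move=> x; apply: le_trans (ler_norm _) _.
by rewrite (le_trans (norm_dotv_mx_le _ _ _)) // -expr2 enorm_sqr.
Qed.

Lemma quad_bounds_dot L lo hi x y : quad_bounds L lo hi ->
  `|dotv x (L *m y)| <= hi * (enorm x * enorm y).
Proof.
move=> [sL lo0 Llo Lhi].
have pL0 z : 0 <= dotv z (L *m z).
  by apply: le_trans (Llo z); rewrite mulr_ge0 ?dotv_ge0 // ltW.
(* The sign of [hi] is not part of [quad_bounds]; only a nonzero vector forces [hi >= 0]. This is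
   also why later constants contain [|hi|]. *)
have [x0|x_neq0] := eqVneq x 0.
  by rewrite x0 dotv0l normr0 enorm0 mul0r mulr0.
have xx0 : 0 < dotv x x.
  by rewrite lt_def dotv_ge0 andbT; apply: contra_neq x_neq0 => /dotv_eq0.
have hi0 : 0 <= hi.
  by rewrite -(pmulr_lge0 _ xx0) (le_trans (pL0 x)).
rewrite -ler_sqr ?nnegrE ?mulr_ge0 ?enorm_ge0 // real_normK ?num_real //.
rewrite (le_trans (psd_cauchy_schwarz _ _ sL pL0)) //.
by rewrite !exprMn !enorm_sqr expr2 mulrACA ler_pM // Lhi.
Qed.

Lemma lnorm_sqr L x : (forall z, 0 <= dotv z (L *m z)) ->
  lnorm L x ^+ 2 = dotv x (L *m x).
Proof. by move=> pL; rewrite sqr_sqrtr. Qed.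

End Euclidean.

(** * Proximal maps *)

Section Continuity.
Context {R : realType}.

Lemma mx_continuous (T : topologicalType) m n (F : T -> 'M[R]_(m, n)) :
  (forall i j, continuous (fun t => F t i j)) -> continuous F.
Proof.
move=> cF t; apply/cvg_ballP => e e0.
have H : forall i j, \forall s \near t, ball (F t i j) e (F s i j).
  by move=> i j; have /cvg_ballP := cF i j t; apply.
have {}H : \forall s \near t, forall i j, ball (F t i j) e (F s i j).
  by apply: filter_forall => i; apply: filter_forall => j; exact: H.
suff : \forall s \near t, ball (F t) e (F s) by [].
by apply: filterS H => s Hs; split.
Qed.

Lemma sum_continuous (T : topologicalType) (I : Type) (s : seq I) (F : I -> T -> R) :
  (forall i, continuous (F i)) -> continuous (fun t => \sum_(i <- s) F i t).
Proof.
move=> cF; elim: s => [|i s IH] t.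
  by under eq_fun do rewrite big_nil; exact: cvg_cst.
have -> : (fun t => \sum_(i <- i :: s) F i t) = (fun t => F i t + \sum_(i <- s) F i t).
  by apply/funext => t'; rewrite big_cons.
by apply: cvgD; [exact: cF|exact: IH].
Qed.

Lemma mulmx_continuous (T : topologicalType) m n p
    (A : T -> 'M[R]_(m, n)) (B : T -> 'M[R]_(n, p)) :
  continuous A -> continuous B -> continuous (fun t => A t *m B t).
Proof.
move=> cA cB; apply: mx_continuous => i j; under eq_fun do rewrite mxE.
apply: sum_continuous => k t; apply: cvgM.
  exact: (cvg_comp _ _ (cA t) (@coord_continuous _ _ _ i k (A t))).
exact: (cvg_comp _ _ (cB t) (@coord_continuous _ _ _ k j (B t))).
Qed.

Lemma continuous_subr (T : topologicalType) (c : R) (f : T -> R) :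
  continuous f -> continuous (fun t => c - f t).
Proof. by move=> cf t; apply: cvgB; [exact: cvg_cst|exact: cf]. Qed.

Lemma continuous_mull (T : topologicalType) (c : R) (f : T -> R) :
  continuous f -> continuous (fun t => c * f t).
Proof. by move=> cf t; apply: cvgM; [exact: cvg_cst|exact: cf]. Qed.

Lemma subl_continuous m n (u : 'M[R]_(m, n)) : continuous (fun y : 'M[R]_(m, n) => u - y).
Proof.
apply: mx_continuous => i j; under eq_fun do rewrite !mxE.
by apply: continuous_subr; exact: coord_continuous.
Qed.

Lemma dotv_continuous (T : topologicalType) n (f g : T -> 'cV[R]_n) :
  continuous f -> continuous g -> continuous (fun t => dotv (f t) (g t)).
Proof.
move=> cf cg; apply: sum_continuous => k t; apply: cvgM.
  exact: (cvg_comp _ _ (cf t) (@coord_continuous _ _ _ k 0 (f t))).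
exact: (cvg_comp _ _ (cg t) (@coord_continuous _ _ _ k 0 (g t))).
Qed.

Lemma enorm_continuous n : continuous (@enorm R n).
Proof.
have -> : @enorm R n = @Num.sqrt R \o (fun y => dotv y y) by [].
move=> x; apply: continuous_comp; last exact: sqrt_continuous.
by apply: dotv_continuous => y; exact: cvg_id.
Qed.

Lemma continuous_at_dominated (T : topologicalType) (g N : T -> R) x :
  (forall y, `|g x - g y| <= N y) -> {for x, continuous N} -> N x = 0 ->
  {for x, continuous g}.
Proof.
move=> gN cN Nx0; apply/cvgrPdist_le => e e0.
move: cN; rewrite /prop_for /continuous_at Nx0.
move=> /cvgrPdist_le /(_ e e0); apply: filterS => y.
by rewrite sub0r normrN => /(le_trans (ler_norm _)); apply: le_trans.
Qed.

(** The topology on vectors is that of the maximum norm while the estimate is Euclidean; the two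
    meet coordinate by coordinate. *)
Lemma lipschitz_continuous m n (F : 'cV[R]_m -> 'cV[R]_n) C :
  (forall x y, enorm (F x - F y) <= C * enorm (x - y)) -> continuous F.
Proof.
move=> LF; apply: mx_continuous => i j x; rewrite (ord1 j).
apply: (@continuous_at_dominated _ (fun y => F y i 0) (fun y => C * enorm (x - y)) x).
- move=> y; apply: le_trans (LF _ _).
  by have := enorm_coord (F x - F y) i; rewrite !mxE.
- have cB : continuous (fun y : 'cV[R]_m => x - y).
    exact: subl_continuous.
  have cN : continuous (fun y : 'cV[R]_m => enorm (x - y)).
    by move=> y; apply: continuous_comp; [exact: cB|exact: enorm_continuous].
  have cC : continuous (fun y : 'cV[R]_m => C * enorm (x - y)).
    exact: continuous_mull.
  exact: cC.
- by rewrite subrr enorm0 mulr0.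
Qed.

(** A box, unlike a Euclidean ball, is a product of segments; transposition carries compactness from
    row vectors to columns. *)
Lemma box_compact n (c : 'cV[R]_n) (rho : R) :
  compact [set x : 'cV[R]_n | forall i, `|x i 0 - c i 0| <= rho].
Proof.
have -> : [set x : 'cV[R]_n | forall i, `|x i 0 - c i 0| <= rho] =
  trmx @` [set v : 'rV[R]_n | forall i,
    `[c i 0 - rho, c i 0 + rho]%classic (v ord0 i)].
  apply/seteqP; split => [x /= xc|_ [v vc <-] i] /=.
    exists x^T; last by rewrite trmxK.
    by move=> i; rewrite mxE /= in_itv /= -ler_distl.
  by rewrite mxE ler_distl; have := vc i; rewrite /= in_itv.
apply: continuous_compact.
  apply: continuous_subspaceT; apply: mx_continuous => i j.
  by under eq_fun do rewrite mxE; exact: coord_continuous.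
apply: (rV_compact (A := fun i => `[c i 0 - rho, c i 0 + rho]%classic)) => i.
exact: segment_compact.
Qed.

End Continuity.

(** * Lower semicontinuous functions *)

Section LowerSemicontinuity.
Context {R : realType} {T : ptopologicalType}.
Local Open Scope ereal_scope.

(** Without a minimiser the open sets [{y | h z < h y}], [z] in [K], cover [K]. In a finite subcover
    the index with the least value lies in [K] but in none of the sets. *)
Lemma lsc_compact_min (h : T -> \bar R) (K : set T) x0 :
  lower_semicontinuous h -> (forall x, h x != -oo) -> compact K -> K x0 ->
  exists2 y, K y & forall z, K z -> h y <= h z.
Proof.
move=> lsch hNy; rewrite compact_cover => cK Kx0.
apply: contrapT => nomin.
have [|y Ky|D' D'K Kcov] := cK T K (fun z => [set y | h z < h y]).
- move=> z _; case: (h z) (hNy z) => [a _| _|//].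
    by move/lower_semicontinuousP : lsch; exact.
  rewrite [X in open X](_ : _ = set0); first exact: open0.
  by apply/seteqP; split => // y /=; rewrite ltNge leey.
- apply: contrapT => ycov; apply: nomin; exists y => // z Kz.
  by rewrite leNgt; apply/negP => zy; apply: ycov; exists z.
have minD (s : seq T) : s != [::] ->
    exists2 y, y \in s & forall z, z \in s -> h y <= h z.
  elim: s => // a [|b s] IH _.
    by exists a; rewrite ?mem_head // => z; rewrite inE => /eqP ->.
  have [//|y ys ymin] := IH; have [ay|ya] := leP (h a) (h y).
    exists a; rewrite ?mem_head // => z; rewrite inE => /predU1P[->//|/ymin].
    exact: le_trans.
  exists y; first by rewrite inE ys orbT.
  by move=> z; rewrite inE => /predU1P[->|/ymin//]; exact: ltW.
have [z0 z0D _] := Kcov _ Kx0.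
have [|y yD ymin] := minD (finmap.enum_fset D').
  by apply/negP => /eqP D0; move: z0D; rewrite /= -[_ \in _]/(z0 \in finmap.enum_fset D') D0.
have [z zD /= zy] := Kcov _ (set_mem (D'K _ yD)).
by have := ymin _ zD; rewrite leNgt zy.
Qed.

Lemma lsc_add_continuous (h : T -> \bar R) (q : T -> R) :
  lower_semicontinuous h -> (forall x, h x != -oo) -> continuous q ->
  lower_semicontinuous (fun x => h x + (q x)%:E).
Proof.
move=> lsch hNy cq x a ax.
(* A level strictly between [a - q x] and [h x]: near [x] the function [h] stays above [b], and the
   gap [b - (a - q x)] is the tolerance left for [q]. *)
have [b ab bh] : exists2 b, (a - q x < b)%R & b%:E < h x.
  case: (h x) (hNy x) ax => [s _| _ _|//].
    rewrite -EFinD lte_fin => ax; exists ((a - q x + s) / 2)%R; first lra.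
    by rewrite lte_fin; lra.
  by exists (a - q x + 1)%R; [lra|rewrite ltry].
have [V Vx VP] := lsch _ _ bh.
have d0 : (0 < b - (a - q x))%R by lra.
have /cvgrPdist_lt /(_ _ d0) W := cq x.
exists (V `&` [set y | (`|q x - q y| < b - (a - q x))%R]); first exact: filterI.
move=> y [/VP hy /=]; rewrite ltr_norml => /andP[_ qy].
apply: (@lt_trans _ _ (b + q y)%:E); first by rewrite lte_fin; lra.
by rewrite EFinD lteD2rE.
Qed.

End LowerSemicontinuity.

Lemma sqr_le_sum (R : realFieldType) (a s t : R) :
  0 <= a -> a <= s + t -> a ^+ 2 <= 2 * s ^+ 2 + 2 * t ^+ 2.
Proof.
move=> a0 ast; apply: (@le_trans _ _ ((s + t) ^+ 2)).
  by rewrite lerXn2r // nnegrE // (le_trans a0).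
by have := sqr_ge0 (s - t); rewrite sqrrB sqrrD; lra.
Qed.

(** * Existence and variational inequality of the proximal map *)

Section Prox.
Context {R : realType} {n : nat}.
Variable r : 'cV[R]_n -> \bar R.
Hypotheses (rconv : econvex r) (rlsc : lower_semicontinuous r) (rprop : proper_fun r).
Implicit Types (x y z u g : 'cV[R]_n) (L : 'M[R]_n).

Let rf x := fine (r x).

Lemma edom_fineK x : edom r x -> r x = (rf x)%:E.
Proof.
move=> rx; rewrite /rf fineK // fin_numE rprop.1.
by rewrite /edom /= in rx; rewrite lt_eqF.
Qed.

Lemma econvex_fine x y (t : R) : edom r x -> edom r y -> 0 <= t <= 1 ->
  edom r (t *: x + (1 - t) *: y) /\
  rf (t *: x + (1 - t) *: y) <= t * rf x + (1 - t) * rf y.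
Proof.
move=> dx dy t01; have := rconv x y t01.
rewrite (edom_fineK dx) (edom_fineK dy) -!EFinM -EFinD => h.
have d : edom r (t *: x + (1 - t) *: y) by rewrite /edom /= (le_lt_trans h) // ltry.
by split=> //; rewrite -lee_fin -(edom_fineK d).
Qed.

Variables (L : 'M[R]_n) (lo hi : R).
Hypothesis qL : quad_bounds L lo hi.

Let Q x := dotv x (L *m x).

Let Q0 x : 0 <= Q x.
Proof.
case: qL => _ lo0 Llo _; apply: le_trans (Llo x).
by rewrite mulr_ge0 ?dotv_ge0 // ltW.
Qed.

Let QE x : lnorm L x ^+ 2 = Q x.
Proof. exact: lnorm_sqr. Qed.

Let QB x y t : Q (x - t *: y) = Q x - 2 * t * dotv (L *m x) y + t ^+ 2 * Q y.
Proof.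
have [sL _ _ _] := qL.
rewrite /Q mulmxBr -scalemxAr !(dotvBl, dotvBr, dotvZl, dotvZr).
by rewrite (dotv_symC x y sL) [dotv (L *m x) y]dotvC; ring.
Qed.

(* Outside a unit box around a point [y0] of the domain, convexity bounds [r]
   below by an affine function of [|y - y0|], with the minimum [m] of [r] on that
   box; this replaces the usual affine minorant. *)
Lemma prox_min u z :
  (r (prox L r u) + (2^-1 * lnorm L (u - prox L r u) ^+ 2)%:E
    <= r z + (2^-1 * lnorm L (u - z) ^+ 2)%:E)%E.
Proof.
suff : exists y, forall z, (r y + (2^-1 * lnorm L (u - y) ^+ 2)%:E
    <= r z + (2^-1 * lnorm L (u - z) ^+ 2)%:E)%E.
  by move=> ex; exact: (@xgetPex _ 0 _ ex).
have [rNy [y0 dy0]] := rprop => {z}.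
pose q y := 2^-1 * lnorm L (u - y) ^+ 2.
have qE y : q y = 2^-1 * Q (u - y) by rewrite /q QE.
have cq : continuous q.
  rewrite (_ : q = fun y => 2^-1 * Q (u - y)); last exact/funext.
  have cu : continuous (fun y : 'cV[R]_n => u - y).
    exact: subl_continuous.
  apply: continuous_mull.
  apply: (dotv_continuous cu); apply: (mulmx_continuous _ cu).
  exact: cst_continuous.
have lscq := lsc_add_continuous rlsc rNy cq.
have K0 (rho : R) : 0 <= rho -> [set x | forall i, `|x i 0 - y0 i 0| <= rho] y0.
  by move=> ? i; rewrite subrr normr0.
have [ym Kym mmin] := lsc_compact_min rlsc rNy (@box_compact _ _ y0 1) (K0 _ ler01).
have dym : edom r ym by apply: le_lt_trans dy0; exact: mmin (K0 _ ler01).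
have growth z : edom r z -> 1 <= enorm (z - y0) ->
    rf y0 - enorm (z - y0) * (rf y0 - rf ym) <= rf z.
  move=> dz; set rho := enorm _ => rho1.
  have rho0 : 0 < rho by lra.
  have t01 : 0 <= rho^-1 <= 1 by rewrite invr_ge0 ltW //= invf_le1.
  have [dp] := econvex_fine dz dy0 t01.
  have Kp : [set x | forall i, `|x i 0 - y0 i 0| <= 1]
      (rho^-1 *: z + (1 - rho^-1) *: y0).
    move=> i; have := enorm_coord (z - y0) i; rewrite -/rho !mxE => zi.
    rewrite (_ : _ - _ = rho^-1 * (z i 0 - y0 i 0)); last by ring.
    by rewrite normrM gtr0_norm ?invr_gt0 // mulrC ler_pdivrMr // mul1r.
  have := mmin _ Kp; rewrite (edom_fineK dp) (edom_fineK dym) lee_fin => h1 h2.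
  have := le_trans h1 h2; rewrite -(ler_pM2l rho0) mulrDr !mulrA mulfV ?gt_eqF //.
  by rewrite mulrBr mulfV ?gt_eqF // mulr1 mul1r; lra.
have [sL lo0 Llo Lhi] := qL.
have D0 : 0 <= rf y0 - rf ym.
  by have := mmin _ (K0 _ ler01); rewrite (edom_fineK dy0) (edom_fineK dym) lee_fin subr_ge0.
pose b2 := dotv (u - y0) (u - y0).
(* With [rho = |z - y0|], the quadratic satisfies [q z >= lo rho^2 / 4 - lo b2 / 2], while [r] loses
   at most [rho (rf y0 - rf ym)]. For [rho >= 1] and [rho >= 4 E / lo] the quadratic wins, so
   minimising over the box of radius [rho0] suffices. *)
pose E := rf y0 - rf ym + q y0 + 2^-1 * lo * b2 + 1.
have b20 : 0 <= b2 by exact: dotv_ge0.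
have qy0 : 0 <= q y0 by rewrite qE mulr_ge0.
have lb : 0 <= 2^-1 * lo * b2 by rewrite !mulr_ge0 // ltW.
have E1 : 1 <= E by rewrite /E; lra.
pose rho0 := 4 * lo^-1 * E + 1.
have ilo : 0 < lo^-1 by rewrite invr_gt0.
have ? : 0 <= 4 * lo^-1 * E by rewrite !mulr_ge0 //; lra.
have rho01 : 1 <= rho0 by rewrite /rho0; lra.
have far z : edom r z -> rho0 <= enorm (z - y0) -> rf y0 + q y0 <= rf z + q z.
  move=> dz; have := growth z dz; set rho := enorm _ => growz rhoz.
  have rho1 : 1 <= rho by lra.
  have {}growz := growz rho1.
  have h1 : E <= 4^-1 * lo * rho.
    have : 4 * lo^-1 * E <= rho by move: rhoz; rewrite /rho0; lra.
    rewrite -(ler_pM2l lo0) !mulrA [lo * 4]mulrC -[4 * lo * _]mulrA mulfV ?gt_eqF //.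
    lra.
  have h2 : rho ^+ 2 <= 2 * dotv (u - z) (u - z) + 2 * b2.
    rewrite -enorm_sqr /b2 -enorm_sqr; apply: sqr_le_sum; first exact: enorm_ge0.
    rewrite addrC /rho (_ : z - y0 = (u - y0) - (u - z)); first exact: enormB.
    by apply/matrixP => i j; rewrite !mxE; ring.
  have := Llo (u - z); rewrite -/(Q _) => h3.
  rewrite [q z]qE; move: (Q _) (dotv _ _) h2 h3 => Qz dz2 h2 h3.
  have h4 : rho * E <= 4^-1 * lo * rho ^+ 2 by rewrite expr2; nra.
  have h5 : lo * rho ^+ 2 <= 2 * (lo * dz2) + 2 * (lo * b2) by nra.
  have h6 : rho * (rf y0 - rf ym) + (q y0 + 2^-1 * lo * b2) <= rho * E.
    rewrite /E; move: lb; set lb2 := 2^-1 * lo * b2 => lb.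
    nra.
  lra.
have phiNy x : (r x + (q x)%:E)%E != -oo%E by rewrite adde_eq_ninfty negb_or rNy.
have [ys Ks ysmin] := lsc_compact_min lscq phiNy (@box_compact _ _ y0 rho0)
  (K0 _ (le_trans ler01 rho01)).
exists ys => z.
have [Kz|nKz] := pselect ([set x | forall i, `|x i 0 - y0 i 0| <= rho0] z).
  exact: ysmin.
have [dz|ndz] := pselect (edom r z); last first.
  have -> : r z = +oo%E.
    by apply/eqP; rewrite -leye_eq leNgt; apply/negP.
  by rewrite addye // leey.
have := ysmin _ (K0 _ (le_trans ler01 rho01)) => /le_trans; apply.
rewrite (edom_fineK dy0) (edom_fineK dz) -!EFinD lee_fin; apply: far => //.
rewrite leNgt; apply/negP => /ltW zr; apply: nKz => i.
by apply: le_trans zr; have := enorm_coord (z - y0) i; rewrite !mxE.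
Qed.

Lemma edom_prox u : edom r (prox L r u).
Proof.
have [y0 dy0] := rprop.2.
have := prox_min u y0; rewrite (edom_fineK dy0) -EFinD => h.
rewrite /edom /= ltNge leye_eq; apply/negP => /eqP ry.
by move: h; rewrite ry addye // leye_eq.
Qed.

(** With [p = prox L r u], this makes [L (u - p)] a subgradient of [r] at [p]: compare [p] with
    [p + t (z - p)] for small [t]. *)
Lemma prox_subgradient u z : edom r z ->
  rf (prox L r u) + dotv (L *m (u - prox L r u)) (z - prox L r u) <= rf z.
Proof.
move=> dz; have dp := edom_prox u; move: (prox_min u) dp.
set p := prox L r u => pmin dp.
have [sL lo0 _ _] := qL.
pose A := rf p + dotv (L *m (u - p)) (z - p) - rf z.
have H t : 0 < t <= 1 -> A <= 2^-1 * t * Q (z - p).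
  move=> /andP[t0 t1].
  have [dt rt] := econvex_fine dz dp (introT andP (conj (ltW t0) t1)).
  have := pmin (t *: z + (1 - t) *: p).
  rewrite (edom_fineK dp) (edom_fineK dt) -!EFinD lee_fin !QE.
  rewrite (_ : u - (t *: z + _) = (u - p) - t *: (z - p)); last first.
    by apply/matrixP => i j; rewrite !mxE; ring.
  rewrite QB => h; rewrite -(ler_pM2l t0) /A; move: rt h.
  move: (dotv _ (z - p)) (rf p) (rf z) (rf _) (Q _) (Q _) => *; nra.
suff : A <= 0 by rewrite /A; lra.
rewrite leNgt; apply/negP => A0.
have AQ : 0 < A + Q (z - p) by rewrite ltr_wpDr.
(* An explicit [t] replaces the limit at 0: it satisfies [t Q(z - p) = A - t A < A], contradicting
   [A <= t Q(z - p) / 2]. *)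
pose t := A / (A + Q (z - p)).
have tE : t * (A + Q (z - p)) = A by rewrite /t mulfVK // gt_eqF.
have t0 : 0 < t by rewrite divr_gt0.
have /H : 0 < t <= 1 by rewrite t0 /= ler_pdivrMr // mul1r lerDl.
have tA : 0 < t * A by rewrite mulr_gt0.
by move: tE; rewrite mulrDr -mulrA; lra.
Qed.

End Prox.

(** * Comparison of proximal residuals *)

Section ProximalResidual.
Context {R : realType} {n : nat}.
Variable r : 'cV[R]_n -> \bar R.
Hypotheses (rconv : econvex r) (rlsc : lower_semicontinuous r) (rprop : proper_fun r).
Implicit Types (x y z u g : 'cV[R]_n) (L : 'M[R]_n).

(** Monotonicity of the subdifferential of [r], obtained by adding the two subgradient inequalities.
    Since [r] alone matters, the two metrics may differ. *)
Lemma prox_monotone L1 L2 lo1 hi1 lo2 hi2 u1 u2 :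
  quad_bounds L1 lo1 hi1 -> quad_bounds L2 lo2 hi2 ->
  0 <= dotv (L1 *m (u1 - prox L1 r u1) - L2 *m (u2 - prox L2 r u2))
            (prox L1 r u1 - prox L2 r u2).
Proof.
move=> q1 q2.
have := prox_subgradient rconv rlsc rprop q1 u1 (edom_prox rconv rlsc rprop q2 u2).
have := prox_subgradient rconv rlsc rprop q2 u2 (edom_prox rconv rlsc rprop q1 u1).
move: (prox L1 r u1) (prox L2 r u2) => p1 p2.
rewrite dotvBl -[p2 - p1]opprB dotvNr.
move: (dotv (L1 *m _) (p1 - p2)) (dotv (L2 *m _) (p1 - p2)) (fine _) (fine _).
by move=> *; lra.
Qed.

(** It serves the continuity of [prox], so a crude Euclidean constant is enough. *)
Lemma prox_lipschitz L lo hi u1 u2 : quad_bounds L lo hi ->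
  enorm (prox L r u1 - prox L r u2) <= `|hi| / lo * enorm (u1 - u2).
Proof.
move=> qL; have [sL lo0 Llo _] := qL.
have := prox_monotone u1 u2 qL qL.
move: (prox L r u1) (prox L r u2) => p1 p2; rewrite -mulmxBr.
rewrite (_ : u1 - p1 - (u2 - p2) = (u1 - u2) - (p1 - p2)); last first.
  by apply/matrixP => i j; rewrite !mxE; ring.
rewrite mulmxBr dotvBl [dotv (L *m (p1 - p2)) _]dotvC [dotv (L *m (u1 - u2)) _]dotvC.
have := quad_bounds_dot (p1 - p2) (u1 - u2) qL => /(le_trans (ler_norm _)) h1 h2.
have h3 := Llo (p1 - p2); rewrite -enorm_sqr in h3.
have {h1}h1 : dotv (p1 - p2) (L *m (u1 - u2)) <=
    enorm (p1 - p2) * (`|hi| * enorm (u1 - u2)).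
  rewrite (le_trans h1) // mulrCA !mulrA ler_wpM2r ?enorm_ge0 //.
  by rewrite ler_wpM2l ?enorm_ge0 // ler_norm.
have := enorm_ge0 (p1 - p2); rewrite le0r => /predU1P[->|e0].
  by rewrite !mulr_ge0 ?enorm_ge0 // invr_ge0 ltW.
rewrite mulrAC ler_pdivlMr // -(ler_pM2l e0).
by move: h3; rewrite expr2; lra.
Qed.

(** Since [L (u - prox u) = L F - g], monotonicity becomes an inequality [<L1 F1 - v, w - F1> >= 0]
    in which [v] and [w] are controlled by the right-hand side [D]. Expanding gives
    [lo1 t^2 <= K t D + K D^2] for [t = |F1|]. *)
Lemma FL_compare L1 L2 lo1 hi1 lo2 hi2 g1 g2 x1 x2 :
  quad_bounds L1 lo1 hi1 -> quad_bounds L2 lo2 hi2 ->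
  enorm (FL L1 r g1 x1) <= (1 + 2 * (1 + `|hi1| + `|hi2|) / lo1) *
    (enorm (FL L2 r g2 x2) + enorm (g1 - g2) + enorm (x1 - x2)).
Proof.
move=> q1 q2; have [s1 lo10 Llo1 _] := q1.
have := prox_monotone (uL L1 g1 x1) (uL L2 g2 x2) q1 q2.
have key L lo hi g x : quad_bounds L lo hi ->
    L *m (uL L g x - prox L r (uL L g x)) = L *m FL L r g x - g.
  move=> /quad_bounds_spd /spd_unitmx uL.
  rewrite /FL {1}/Defs.uL addrAC mulmxBr mulmxA mulmxV // mul1mx.
  by [].
rewrite (key _ _ _ _ _ q1) (key _ _ _ _ _ q2) => {key}.
have -> : prox L1 r (uL L1 g1 x1) - prox L2 r (uL L2 g2 x2) =
    (x1 - x2 + FL L2 r g2 x2) - FL L1 r g1 x1.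
  rewrite /FL; move: (prox L1 _ _) (prox L2 _ _) => p1 p2.
  by apply/matrixP => i j; rewrite !mxE; ring.
move: (FL L1 r g1 x1) (FL L2 r g2 x2) => F1 F2.
rewrite (_ : L1 *m F1 - g1 - _ = L1 *m F1 - (L2 *m F2 + (g1 - g2))); last first.
  by apply/matrixP => i j; rewrite !mxE; ring.
set w := x1 - x2 + F2; set v := L2 *m F2 + (g1 - g2).
rewrite dotvBl !dotvBr => mono.
set D := enorm F2 + enorm (g1 - g2) + enorm (x1 - x2).
have F20 := enorm_ge0 F2; have g0 := enorm_ge0 (g1 - g2); have x0 := enorm_ge0 (x1 - x2).
have D0 : 0 <= D by rewrite /D; lra.
have wD : enorm w <= D by rewrite (le_trans (enormD _ _)) // /D; lra.
have vD y : `|dotv v y| <= (1 + `|hi2|) * D * enorm y.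
  rewrite /v dotvDl (le_trans (ler_normD _ _)) //.
  have := quad_bounds_dot y F2 q2; rewrite dotvC => h1.
  have h2 := cauchy_schwarz (g1 - g2) y.
  have {h1}h1 : `|dotv (L2 *m F2) y| <= `|hi2| * D * enorm y.
    rewrite (le_trans h1) // [enorm y * _]mulrC mulrA ler_wpM2r ?enorm_ge0 //.
    rewrite (@le_trans _ _ (`|hi2| * enorm F2)) ?ler_wpM2r ?ler_norm //.
    by rewrite ler_wpM2l // /D; lra.
  have {h2}h2 : `|dotv (g1 - g2) y| <= D * enorm y.
    by rewrite (le_trans h2) // ler_wpM2r ?enorm_ge0 // /D; lra.
  by lra.
have h1 : dotv (L1 *m F1) w <= `|hi1| * enorm F1 * D.
  rewrite dotvC (le_trans (ler_norm _)) // (le_trans (quad_bounds_dot _ _ q1)) //.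
  rewrite (@le_trans _ _ (`|hi1| * (enorm w * enorm F1))) //.
    by rewrite ler_wpM2r ?ler_norm // mulr_ge0 // enorm_ge0.
  rewrite -mulrA ler_wpM2l // mulrC ler_wpM2l ?enorm_ge0 //.
have h2 := le_trans (ler_norm _) (vD F1).
have h3 : - dotv v w <= (1 + `|hi2|) * D * D.
  rewrite -dotvNr (le_trans (ler_norm _)) // (le_trans (vD _)) // enormN ler_wpM2l //.
  by rewrite mulr_ge0 // addr_ge0.
have h4 : lo1 * enorm F1 ^+ 2 <= dotv (L1 *m F1) F1 by rewrite enorm_sqr dotvC.
set t := enorm F1 in h1 h2 h4 *; have t0 : 0 <= t by exact: enorm_ge0.
set K := 1 + `|hi1| + `|hi2|.
have n1 : 0 <= `|hi1| by []; have n2 : 0 <= `|hi2| by [].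
have h5 : lo1 * t ^+ 2 <= K * t * D + K * D * D.
  have : 0 <= `|hi1| * D * D by rewrite !mulr_ge0.
  rewrite /K; move: mono h1 h2 h3 h4; lra.
have K0 : 0 <= 2 * K / lo1.
  by rewrite divr_ge0 ?(ltW lo10) // mulr_ge0 // /K !addr_ge0.
(* Either [t <= D], or [D^2 <= t D] and division by [t] gives [t <= 2 K D / lo1]; the constant adds
   up both cases. *)
have [tD|Dt] := leP t D.
  by rewrite mulrDl mul1r (le_trans tD) // lerDl mulr_ge0.
rewrite mulrDl mul1r (@le_trans _ _ (2 * K / lo1 * D)) ?lerDr //.
have tp : 0 < t by lra.
rewrite mulrAC ler_pdivlMr // -(ler_pM2l tp).
have h6 : K * D * D <= K * D * t.
  by rewrite ler_wpM2l ?(ltW Dt) // mulr_ge0 // /K !addr_ge0.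
by move: h5 h6; rewrite expr2; lra.
Qed.

Lemma prox_continuous L lo hi : quad_bounds L lo hi -> continuous (prox L r).
Proof. by move=> qL; apply: lipschitz_continuous => u1 u2; exact: prox_lipschitz qL. Qed.

End ProximalResidual.

(** * Measurability of matrix-valued maps *)

Section MatrixMeasurability.
Context d (T : measurableType d) (R : realType).

(** Entrywise, so that matrix algebra reduces to sums and products of real functions;
    [mx_measurable_open] is the link to the topology on matrices. *)
Definition mx_measurable m n (X : T -> 'M[R]_(m, n)) : Prop :=
  forall i j, measurable_fun setT (fun w => X w i j).

Lemma preimage_itv_measurable (g : T -> R) (I : interval R) :
  measurable_fun setT g -> measurable [set w | g w \in I].
Proof.
move=> mg; have := mg measurableT [set` I] (measurable_itv I).
by rewrite setTI.
Qed.

Lemma measurable_forall_ord m n (A : 'I_m -> 'I_n -> set T) :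
  (forall i j, measurable (A i j)) -> measurable [set w | forall i j, A i j w].
Proof.
move=> mA.
rewrite (_ : [set w | _] = \bigcap_(i in [set: 'I_m]) \bigcap_(j in [set: 'I_n]) A i j).
  apply: fin_bigcap_measurable => [|i _]; first exact: finite_finset.
  by apply: fin_bigcap_measurable => //; exact: finite_finset.
apply/seteqP; split => w /=; first by move=> Aw i _ j _; exact: Aw.
by move=> Aw i j; exact: Aw.
Qed.

(** An open set is a countable union of boxes with rational centre and radius [1/(k+1)], and the
    preimage of a box is given by finitely many conditions on entries. *)
Lemma mx_measurable_open m n (X : T -> 'M[R]_(m, n)) (A : set 'M[R]_(m, n)) :
  mx_measurable X -> open A -> measurable (X @^-1` A).
Proof.
move=> mX oA.
pose c (q : 'M[rat]_(m, n)) : 'M[R]_(m, n) := map_mx ratr q.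
pose F (qk : 'M[rat]_(m, n) * nat) : set T :=
  [set w | (forall i j, X w i j \in `](c qk.1 i j - qk.2.+1%:R^-1), (c qk.1 i j + qk.2.+1%:R^-1)[)
    /\ ball (c qk.1) (qk.2.+1%:R^-1 : R) `<=` A].
have -> : X @^-1` A = \bigcup_qk F qk.
  apply/seteqP; split => [w /= Xw|w [[q k] _] /= [Xq qA]]; last first.
    apply: qA; split; first by rewrite invr_gt0.
    move=> i j; have := Xq i j; rewrite in_itv /= /ball /= => /andP[h1 h2].
    by rewrite ltr_distlC h1.
  move: oA; rewrite openE => /(_ _ Xw) /nbhs_ballP [e /= e0 eA].
  (* Half of [e], since [X w] and a point of the box are each within one radius of the centre. *)
  have [k ke] : exists k, (k.+1%:R^-1 : R) < e / 2.
    have e20 : 0 < e / 2 by rewrite divr_gt0.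
    by have [k _ /(_ k (leqnn k))] := near_infty_natSinv_lt (PosNum e20); exists k.
  have kp : 0 < (k.+1%:R^-1 : R) by rewrite invr_gt0.
  have H i j : exists q : rat, ratr q \in `](X w i j - k.+1%:R^-1), (X w i j + k.+1%:R^-1)[.
    by apply: rat_in_itvoo; rewrite ltrBlDr -addrA ltrDl addr_gt0.
  pose q := \matrix_(i < m, j < n) projT1 (cid (H i j)).
  have Hq i j : ratr (q i j) \in `](X w i j - k.+1%:R^-1), (X w i j + k.+1%:R^-1)[.
    by rewrite mxE; exact: projT2 (cid (H i j)).
  exists (q, k) => //; split => [i j|y [_ yq]] /=.
    have -> : c q i j = ratr (q i j) by rewrite mxE.
    have := Hq i j; rewrite !in_itv /=.
    move: (ratr (q i j) : R) (X w i j) (k.+1%:R^-1 : R) => a b s /andP[h1 h2].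
    by apply/andP; split; lra.
  apply: eA; split => // i j; have := yq i j; have := Hq i j.
  have -> : c q i j = ratr (q i j) by rewrite mxE.
  rewrite /ball /= in_itv /= !ltr_distlC.
  move: (ratr (q i j) : R) (X w i j) (y i j) (k.+1%:R^-1 : R) ke => a b b' s ke.
  by move=> /andP[h1 h2] /andP[h3 h4]; apply/andP; split; lra.
apply: countable_bigcupT_measurable; first exact: countableP.
move=> [q k]; have [qA|qA] := pselect (ball (c q) (k.+1%:R^-1 : R) `<=` A).
  rewrite (_ : F _ = [set w | forall i j,
      X w i j \in `](c q i j - k.+1%:R^-1), (c q i j + k.+1%:R^-1)[]).
    by apply: measurable_forall_ord => i j; apply: preimage_itv_measurable; exact: mX.
  by apply/seteqP; split => w /=; [case|].
rewrite (_ : F _ = set0); first exact: measurable0.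
by apply/seteqP; split => w //= [_ /qA].
Qed.

(** Strict superlevel sets are open and upper rays generate. This serves [r] and [psi], which may be
    discontinuous. *)
Lemma lsc_mx_measurable m n (X : T -> 'M[R]_(m, n)) (h : 'M[R]_(m, n) -> \bar R) :
  mx_measurable X -> lower_semicontinuous h -> measurable_fun setT (fun w => h (X w)).
Proof.
move=> mX hlsc; apply: (measurability _ (ErealGenOInfty.measurableE R)).
move=> /= _ [_ [a ->]] <-; rewrite setTI.
rewrite (_ : _ @^-1` _ = X @^-1` [set x | (a%:E < h x)%E]); last first.
  by apply/seteqP; split => w /=; rewrite in_itv /= andbT.
by apply: mx_measurable_open => //; move/lower_semicontinuousP : hlsc; exact.
Qed.

Lemma continuous_mx_measurable m n (X : T -> 'M[R]_(m, n)) (h : 'M[R]_(m, n) -> R) :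
  mx_measurable X -> continuous h -> measurable_fun setT (fun w => h (X w)).
Proof.
move=> mX ch; apply: (measurability _ (RGenOInfty.measurableE R)).
move=> /= _ [_ [a ->]] <-; rewrite setTI.
rewrite (_ : _ @^-1` _ = X @^-1` (h @^-1` [set y | a < y])); last first.
  by apply/seteqP; split => w /=; rewrite in_itv /= andbT.
apply: mx_measurable_open => //; move/continuousP : ch; apply.
exact: open_gt.
Qed.

Lemma mx_measurable_comp m n p q (X : T -> 'M[R]_(m, n)) (F : 'M[R]_(m, n) -> 'M[R]_(p, q)) :
  mx_measurable X -> continuous F -> mx_measurable (fun w => F (X w)).
Proof.
move=> mX cF i j; apply: (@continuous_mx_measurable _ _ X (fun A => F A i j)) => // A.
exact: (cvg_comp _ _ (cF A) (@coord_continuous _ _ _ i j (F A))).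
Qed.

Lemma mx_measurable_cst m n (A : 'M[R]_(m, n)) : mx_measurable (fun=> A).
Proof. by move=> i j; exact: measurable_cst. Qed.

Lemma mx_measurableD m n (X Y : T -> 'M[R]_(m, n)) :
  mx_measurable X -> mx_measurable Y -> mx_measurable (fun w => X w + Y w).
Proof.
move=> mX mY i j; under eq_fun do rewrite mxE.
by apply: measurable_funD; [exact: mX|exact: mY].
Qed.

Lemma mx_measurableZ m n a (X : T -> 'M[R]_(m, n)) :
  mx_measurable X -> mx_measurable (fun w => a *: X w).
Proof.
move=> mX i j; under eq_fun do rewrite mxE.
by apply: measurable_funM; [exact: measurable_cst|exact: mX].
Qed.

Lemma mx_measurableN m n (X : T -> 'M[R]_(m, n)) :
  mx_measurable X -> mx_measurable (fun w => - X w).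
Proof.
by move=> mX; under eq_fun do rewrite -scaleN1r; exact: mx_measurableZ.
Qed.

Lemma mx_measurableB m n (X Y : T -> 'M[R]_(m, n)) :
  mx_measurable X -> mx_measurable Y -> mx_measurable (fun w => X w - Y w).
Proof. by move=> mX mY; apply: mx_measurableD => //; exact: mx_measurableN. Qed.

Lemma mx_measurable_sum m n (I : Type) (s : seq I) (X : I -> T -> 'M[R]_(m, n)) :
  (forall k, mx_measurable (X k)) -> mx_measurable (fun w => \sum_(k <- s) X k w).
Proof.
move=> mX i j; under eq_fun do rewrite summxE.
by apply: measurable_sum => k; exact: mX.
Qed.

Lemma mx_measurableM m n p (X : T -> 'M[R]_(m, n)) (Y : T -> 'M[R]_(n, p)) :
  mx_measurable X -> mx_measurable Y -> mx_measurable (fun w => X w *m Y w).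
Proof.
move=> mX mY i j; under eq_fun do rewrite mxE.
by apply: measurable_sum => k; apply: measurable_funM; [exact: mX|exact: mY].
Qed.

Lemma mx_measurable_tr m n (X : T -> 'M[R]_(m, n)) :
  mx_measurable X -> mx_measurable (fun w => (X w)^T).
Proof. by move=> mX i j; under eq_fun do rewrite mxE; exact: mX. Qed.

Lemma measurable_det n (X : T -> 'M[R]_n) :
  mx_measurable X -> measurable_fun setT (fun w => \det (X w)).
Proof.
move=> mX; apply: measurable_sum => s; apply: measurable_funM.
  exact: measurable_cst.
by apply: measurable_prod => i _; exact: mX.
Qed.

(** Writing [1/g] as [g (g^2)^(-1)] reduces it to a real power with nonnegative base; both sides
    vanish where [g = 0]. *)
Lemma measurable_funV (g : T -> R) :
  measurable_fun setT g -> measurable_fun setT (fun w => (g w)^-1).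
Proof.
move=> mg.
rewrite (_ : (fun w => _) = fun w => g w * powR (g w ^+ 2) (-1)); last first.
  apply/funext => w; rewrite powR_inv1 ?sqr_ge0 //.
  have [->|g0] := eqVneq (g w) 0; first by rewrite invr0 mul0r.
  by rewrite expr2 invfM mulrA divff // mul1r.
apply: measurable_funM => //.
have mg2 : measurable_fun setT (fun w => g w ^+ 2) by exact: measurable_funX.
have mp : measurable_fun setT (fun x : R => powR x (-1)) by exact: measurable_powR.
exact: (measurableT_comp mp mg2).
Qed.

Lemma mx_measurable_invmx n (X : T -> 'M[R]_n) :
  mx_measurable X -> (forall w, X w \in unitmx) -> mx_measurable (fun w => invmx (X w)).
Proof.
move=> mX uX; rewrite (_ : (fun w => _) = fun w => (\det (X w))^-1 *: \adj (X w)).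
  move=> i j; under eq_fun do rewrite !mxE.
  apply: measurable_funM; first by apply: measurable_funV; exact: measurable_det.
  apply: measurable_funM; first exact: measurable_cst.
  by apply: measurable_det => k l; under eq_fun do rewrite !mxE; exact: mX.
by apply/funext => w; rewrite /invmx uX.
Qed.

Lemma mx_measurable_cvg m n (X : nat -> T -> 'M[R]_(m, n)) (Y : T -> 'M[R]_(m, n)) :
  (forall k, mx_measurable (X k)) ->
  (forall w i j, (fun k => X k w i j) @ \oo --> Y w i j) -> mx_measurable Y.
Proof.
move=> mX XY i j.
by apply: (measurable_fun_cvg (fun k => mX k i j)) => w _; exact: XY.
Qed.

Let grid k m n (A : 'M[R]_(m, n)) : 'M[int]_(m, n) :=
  map_mx (fun a => floor (a * k.+1%:R)) A.

Let grid_pt k m n (z : 'M[int]_(m, n)) : 'M[R]_(m, n) := map_mx (fun a => a%:~R / k.+1%:R) z.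

Let grid_close k m n (A : 'M[R]_(m, n)) i j :
  `|A i j - grid_pt k (grid k A) i j| <= k.+1%:R^-1.
Proof.
rewrite !mxE; have k0 : 0 < (k.+1%:R : R) by [].
have /andP[h1 h2] := floor_itv (A i j * k.+1%:R).
rewrite -[A i j in X in X - _](mulfK (lt0r_neq0 k0)).
rewrite -mulrBl normrM [`|_^-1|]gtr0_norm ?invr_gt0 // ler_piMl ?invr_ge0 //.
by rewrite ler_norml; move: h2; rewrite intrD; lra.
Qed.

(* Composing with the roundings of [X] to the grids of mesh [1/(k+1)] gives
   countably-valued first arguments. *)
Lemma measurable_caratheodory_comp dX (Xi : measurableType dX) m n p q
    (G : 'M[R]_(m, n) -> Xi -> 'M[R]_(p, q)) (X : T -> 'M[R]_(m, n)) (xi : T -> Xi) :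
  (forall v, continuous (fun z => G z v)) ->
  (forall z i j, measurable_fun setT (fun v => G z v i j)) ->
  mx_measurable X -> measurable_fun setT xi -> mx_measurable (fun w => G (X w) (xi w)).
Proof.
move=> cG mG mX mxi.
apply: (@mx_measurable_cvg _ _ (fun k w => G (grid_pt k (grid k (X w))) (xi w))).
  move=> k i j _ B mB; rewrite setTI.
  rewrite (_ : _ @^-1` B = \bigcup_(z : 'M[int]_(m, n))
     ([set w | forall i j, X w i j * k.+1%:R \in `[(z i j)%:~R, (z i j + 1)%:~R[] `&`
      xi @^-1` [set v | B (G (grid_pt k z) v i j)])).
    apply: countable_bigcupT_measurable; first exact: countableP.
    move=> z; apply: measurableI.
      apply: measurable_forall_ord => i' j'.
      apply: (@preimage_itv_measurable (fun w => X w i' j' * k.+1%:R)).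
      by apply: measurable_funM; [exact: mX|exact: measurable_cst].
    rewrite -[_ @^-1` _]setTI; apply: mxi => //.
    by rewrite -[X in measurable X]setTI; exact: mG.
  apply/seteqP; split => [w /= Bw|w [z _ [/= zw Bw]]].
    exists (grid k (X w)) => //; split => // i' j'.
    by rewrite mxE in_itv /=; exact: floor_itv.
  rewrite /= (_ : grid k (X w) = z) //.
  apply/matrixP => i' j'; rewrite mxE; apply: floor_def.
  by have := zw i' j'; rewrite in_itv.
move=> w i j.
have cX : (fun k => grid_pt k (grid k (X w))) @ \oo --> X w.
  apply/cvg_ballP => e e0; have [k _ kP] := near_infty_natSinv_lt (PosNum e0).
  exists k => // l kl; split => // i' j'; rewrite /ball /=.
  by apply: le_lt_trans (grid_close l _ _ _) _; exact: kP.
have := cvg_comp _ _ cX (cG (xi w) (X w)).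
by move=> h; exact: (cvg_comp _ _ h (@coord_continuous _ _ _ i j _)).
Qed.

End MatrixMeasurability.

(** * The Moore-Penrose inverse *)

Section MoorePenrose.
Context {R : realType} {n : nat}.
Implicit Types M : 'M[R]_n.

Lemma gram_unitmx m p (B : 'M[R]_(m, p)) : row_free B -> B *m B^T \in unitmx.
Proof.
move=> fB; rewrite -row_free_unit -kermx_eq0; apply/eqP/row_matrixP => i.
rewrite row0; set u := row i _.
have uB0 : u *m (B *m B^T) = 0 by rewrite /u -row_mul mulmx_ker row0.
apply: (row_free_inj fB); rewrite mul0mx.
apply: trmx_inj; rewrite trmx0; apply: dotv_eq0.
by rewrite dotvE trmxK trmx_mul mulmxA -[u *m B *m _]mulmxA uB0 mul0mx mxE.
Qed.

(** The formula for a full-rank factorisation, [B^T (B B^T)^(-1) (C^T C)^(-1) C^T]; its products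
    with [C B] are the orthogonal projections onto the column space of [C] and the row space of
    [B]. *)
Lemma penrose_factorization k (C : 'M[R]_(n, k)) (B : 'M[R]_(k, n)) :
  B *m B^T \in unitmx -> C^T *m C \in unitmx ->
  exists X : 'M[R]_n, [/\ C *m B *m X *m (C *m B) = C *m B, X *m (C *m B) *m X = X,
    (C *m B *m X)^T = C *m B *m X & (X *m (C *m B))^T = X *m (C *m B)].
Proof.
move=> uB uC; pose GB := invmx (B *m B^T); pose GC := invmx (C^T *m C).
have GBT : GB^T = GB by rewrite /GB trmx_inv trmx_mul trmxK.
have GCT : GC^T = GC by rewrite /GC trmx_inv trmx_mul trmxK.
have KB : B *m B^T *m GB = 1%:M by rewrite mulmxV.
have KC : GC *m (C^T *m C) = 1%:M by rewrite mulVmx.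
have MX : C *m B *m (B^T *m GB *m GC *m C^T) = C *m GC *m C^T.
  rewrite (_ : _ *m _ = C *m (B *m B^T *m GB) *m GC *m C^T); last by rewrite !mulmxA.
  by rewrite KB mulmx1.
have XM : B^T *m GB *m GC *m C^T *m (C *m B) = B^T *m GB *m B.
  rewrite (_ : _ *m _ = B^T *m GB *m (GC *m (C^T *m C)) *m B); last by rewrite !mulmxA.
  by rewrite KC mulmx1.
exists (B^T *m GB *m GC *m C^T); split.
- rewrite MX (_ : _ *m _ = C *m (GC *m (C^T *m C)) *m B); last by rewrite !mulmxA.
  by rewrite KC mulmx1.
- rewrite XM (_ : _ *m _ = B^T *m GB *m (B *m B^T *m GB) *m GC *m C^T).
    by rewrite KB mulmx1.
  by rewrite !mulmxA.
- by rewrite MX !trmx_mul trmxK GCT mulmxA.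
- by rewrite XM !trmx_mul trmxK GBT mulmxA.
Qed.

Lemma mpinv_penrose M : let X := mpinv M in
  M *m X *m M = M /\ X *m M *m X = X /\ (M *m X)^T = M *m X /\ (X *m M)^T = X *m M.
Proof.
suff : exists X : 'M[R]_n, M *m X *m M = M /\ X *m M *m X = X /\
    (M *m X)^T = M *m X /\ (X *m M)^T = X *m M.
  by move=> ex; exact: (@xgetPex _ 0 _ ex).
have uC : (col_base M)^T *m col_base M \in unitmx.
  rewrite -[X in _ *m X]trmxK; apply: gram_unitmx.
  by rewrite /row_free mxrank_tr; have := col_base_full M; rewrite /row_full.
have [X] := penrose_factorization (gram_unitmx (row_base_free M)) uC.
by rewrite mulmx_base => -[]; exists X.
Qed.

Lemma gram_psd M (x : 'cV[R]_n) : 0 <= dotv x ((M^T *m M) *m x).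
Proof. by rewrite -mulmxA dotv_tr trmxK dotv_ge0. Qed.

Lemma gram_shift_unitmx M (e : R) : 0 < e -> M^T *m M + e%:M \in unitmx.
Proof.
move=> e0; apply: spd_unitmx; split=> [|x x0].
  by rewrite linearD /= trmx_mul trmxK tr_scalar_mx.
rewrite mulmxDl dotvDr dotv_scalar ltr_wpDl ?gram_psd // mulr_gt0 //.
by rewrite lt_def dotv_ge0 andbT; apply: contra_neq x0 => /dotv_eq0.
Qed.

(** For [z = (A + e)^(-1) A c] one has [A (c - z) = e z], so positivity of [A] at [c - z] yields
    [<c - z, z> >= 0], that is [|z|^2 <= <c, z>]. *)
Lemma gram_resolvent_contract M (e : R) (c : 'cV[R]_n) : 0 < e ->
  enorm (invmx (M^T *m M + e%:M) *m ((M^T *m M) *m c)) <= enorm c.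
Proof.
move=> e0; set A := M^T *m M; set z := invmx _ *m _.
have uA := gram_shift_unitmx M e0.
have Az : A *m z + e *: z = A *m c.
  by rewrite -[e *: z]mul_scalar_mx -mulmxDl /z mulmxA mulmxV // mul1mx.
have h : 0 <= dotv (c - z) (A *m (c - z)) by exact: gram_psd.
have {h}h : 0 <= dotv (c - z) z.
  rewrite mulmxBr -Az addrAC subrr add0r dotvZr in h.
  by rewrite pmulr_rge0 in h.
have := dotv_le c z; rewrite dotvBl -enorm_sqr in h.
have := enorm_ge0 z; rewrite le0r => /predU1P[->|z0]; first by rewrite enorm_ge0.
by move=> cz; rewrite -(ler_pM2r z0); move: h; rewrite expr2; lra.
Qed.

(* Tikhonov regularisation: with [A = M^T M] and [X] the pseudo-inverse,
   [X = A (X X^T X)] and [(A + e)^-1 M^T = X - e (A + e)^-1 X]. *)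
Lemma mpinv_tikhonov M i j :
  (fun k => (invmx (M^T *m M + (k.+1%:R^-1)%:M) *m M^T) i j) @ \oo --> mpinv M i j.
Proof.
have [] := mpinv_penrose M; set X := mpinv M => P1 [P2 [P3 P4]].
set A := M^T *m M.
have MTA : M^T = A *m X.
  by rewrite /A -mulmxA -P3 trmx_mul -{1}P1 !trmx_mul mulmxA.
have XA : X = A *m (X *m X^T *m X).
  have : X = M^T *m X^T *m X by rewrite -trmx_mul P4.
  by move=> {1}->; rewrite {1}MTA !mulmxA.
set Y := X *m X^T *m X in XA.
have K k : invmx (A + (k.+1%:R^-1)%:M) *m M^T =
    X - k.+1%:R^-1 *: (invmx (A + (k.+1%:R^-1)%:M) *m (A *m Y)).
  have k0 : 0 < (k.+1%:R^-1 : R) by rewrite invr_gt0.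
  have uA := gram_shift_unitmx M k0.
  apply: (can_inj (mulKmx uA)); rewrite mulmxBr -scalemxAr !mulKVmx //.
  by rewrite -XA mulmxDl mul_scalar_mx addrK.
apply/cvgrPdist_le => e e0.
pose c := enorm (col j Y).
have c0 : 0 < c + 1 by rewrite ltr_wpDl // enorm_ge0.
have ec0 : 0 < e / (c + 1) by rewrite divr_gt0.
have [k _ kP] := near_infty_natSinv_lt (PosNum ec0).
exists k => // l /kP /= le.
have l0 : 0 < (l.+1%:R^-1 : R) by rewrite invr_gt0.
have h : `|(invmx (A + (l.+1%:R^-1)%:M) *m (A *m Y)) i j| <= c.
  have := gram_resolvent_contract M (col j Y) l0; rewrite -/A -/c.
  have -> : invmx (A + (l.+1%:R^-1)%:M) *m (A *m col j Y) =
      col j (invmx (A + (l.+1%:R^-1)%:M) *m (A *m Y)) by rewrite !colE !mulmxA.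
  move: (invmx _ *m (A *m Y)) => Z; apply: le_trans.
  by have := enorm_coord (col j Z) i; rewrite mxE.
rewrite K; move: (invmx _ *m (A *m Y)) h => Z h.
rewrite !mxE opprB addrC subrK normrM gtr0_norm //.
rewrite -[X in _ <= X](mulfVK (lt0r_neq0 c0)) ler_pM ?(ltW l0) ?(ltW le) //.
by rewrite (le_trans h) // lerDl.
Qed.

End MoorePenrose.

(** Continuity fails at changes of rank; the regularised inverses are measurable and converge
    pointwise. *)
Lemma mx_measurable_mpinv d (T : measurableType d) (R : realType) n (M : T -> 'M[R]_n) :
  mx_measurable M -> mx_measurable (fun w => mpinv (M w)).
Proof.
move=> mM; apply: (@mx_measurable_cvg _ _ _ _ _
  (fun k w => invmx ((M w)^T *m M w + (k.+1%:R^-1)%:M) *m (M w)^T)) => [k|w i j].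
  have mT := mx_measurable_tr mM.
  apply: mx_measurableM => //; apply: mx_measurable_invmx => [|w].
    have mA : mx_measurable (fun w => (M w)^T *m M w) := mx_measurableM mT mM.
    by apply: mx_measurableD mA _; exact: mx_measurable_cst.
  by apply: gram_shift_unitmx; rewrite invr_gt0.
exact: mpinv_tikhonov.
Qed.

(** * Real sequences *)

Section Series.
Context {R : realType}.
Implicit Types (a : nat -> R) (u : nat -> \bar R).

Lemma nneseries_bounded a : (forall k, 0 <= a k) ->
  (\sum_(0 <= k <oo) (a k)%:E < +oo)%E ->
  exists2 S, 0 <= S & forall N, \sum_(0 <= k < N) a k <= S.
Proof.
move=> a0; set s := (\sum_(0 <= k <oo) _)%E => sfin.
have s0 : (0 <= s)%E by apply: nneseries_ge0 => k _ _; rewrite lee_fin.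
exists (fine s); first by rewrite fine_ge0.
move=> N; rewrite -lee_fin -sumEFin fineK ?ge0_fin_numE //.
by apply: (nneseries_lim_ge N) => k _ _; rewrite lee_fin.
Qed.

Lemma bounded_nneseries a S : (forall k, 0 <= a k) ->
  (forall N, \sum_(0 <= k < N) a k <= S) -> (\sum_(0 <= k <oo) (a k)%:E < +oo)%E.
Proof.
move=> a0 aS; apply: (@le_lt_trans _ _ S%:E); last exact: ltry.
apply: lime_le; first by apply: is_cvg_nneseries => k _ _; rewrite lee_fin.
by apply: nearW => N; rewrite sumEFin lee_fin.
Qed.

Lemma summable_eventually_le a S (e : R) : (forall k, 0 <= a k) ->
  (forall N, \sum_(0 <= k < N) a k <= S) -> 0 < e ->
  exists N, forall k, (N <= k)%N -> a k <= e.
Proof.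
move=> a0 aS e0.
have : cvgn (series a).
  apply: nondecreasing_is_cvgn; first exact: nondecreasing_series.
  by exists S => _ [N _ <-]; rewrite /series /=.
move=> /cvg_series_cvg_0 /cvgrPdist_le /(_ e e0) [N _ NP].
by exists N => k /NP /=; rewrite sub0r normrN ger0_norm.
Qed.

Lemma limn_einf_eq0 u : (forall k, 0 <= u k)%E ->
  (forall (e : R) N, 0 < e -> exists2 k, (N <= k)%N & (u k <= e%:E)%E) ->
  limn_einf u = 0%E.
Proof.
move=> u0 uP; rewrite limn_einf_lim.
have -> : einfs u = cst 0%E; last exact: lim_cst.
apply/funext => N /=; apply/eqP; rewrite eq_le; apply/andP; split.
  apply/lee_addgt0Pr => e e0; rewrite add0e.
  have [k Nk uk] := uP e N e0; apply: le_trans uk.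
  by apply: ereal_inf_lbound; exists k.
by apply: le_ereal_inf_tmp => _ [k _ <-].
Qed.

(** If [u_k > e] from [N] on, the weights after [N] sum to at most [C / e]. The values of [u] are
    extended reals so that expectations not known to be finite are allowed. *)
Lemma divergent_weights_small a u (C : R) : (forall k, 0 <= a k) ->
  (\sum_(0 <= k <oo) (a k)%:E = +oo)%E -> (forall k, 0 <= u k)%E ->
  (forall N, \sum_(0 <= k < N) (a k)%:E * u k <= C%:E)%E ->
  forall (e : R) N, 0 < e -> exists2 k, (N <= k)%N & (u k <= e%:E)%E.
Proof.
move=> a0 ainf u0 uC e N e0; apply: contrapT => nk.
have {nk}ue k : (N <= k)%N -> (e%:E <= u k)%E.
  move=> Nk; have [//|ku] := leP e%:E (u k); exfalso; apply: nk.
  by exists k => //; exact: ltW.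
suff : (\sum_(0 <= k <oo) (a k)%:E < +oo)%E by rewrite ainf ltxx.
apply: (@bounded_nneseries _ (\sum_(0 <= k < N) a k + C / e)) => // M.
have aN0 : 0 <= \sum_(0 <= k < N) a k by exact: sumr_ge0.
have C0 : 0 <= C.
  by have := uC 0%N; rewrite big_nil lee_fin.
have [MN|/ltnW NM] := leqP M N.
  rewrite (@le_trans _ _ (\sum_(0 <= k < N) a k)) //.
    by rewrite [leRHS](big_cat_nat (leq0n _) MN) /= lerDl sumr_ge0.
  by rewrite lerDl divr_ge0 // ltW.
rewrite (big_cat_nat (leq0n _) NM) /= lerD2l ler_pdivlMr // mulr_suml.
rewrite -lee_fin -sumEFin; apply: le_trans (uC M).
rewrite [leRHS](big_cat_nat (leq0n _) NM) /=.
apply: (@le_trans _ _ (\sum_(N <= k < M) (a k)%:E * u k)%E).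
  rewrite big_nat_cond [leRHS]big_nat_cond; apply: lee_sum => k /andP[/andP[Nk _] _].
  by rewrite EFinM lee_wpmul2l ?lee_fin // ue.
by rewrite leeDr // sume_ge0 // => k _; rewrite mule_ge0 ?lee_fin.
Qed.

End Series.

(** * Summability along accepted steps *)

Section Contraction.
Context {R : realType}.
Variables (eta p theta0 : R) (nu eps : nat -> R).
Hypotheses (eta01 : 0 < eta < 1) (p01 : 0 < p < 1) (theta0_ge0 : 0 <= theta0).
Hypotheses (nu_ge0 : forall k, 0 <= nu k) (eps_ge0 : forall k, 0 <= eps k).

(** Dividing by [x + y] reduces it to [s <= s^p] for [s] in the unit interval. *)
Lemma powR_subadditive (x y : R) : 0 <= x -> 0 <= y ->
  powR (x + y) p <= powR x p + powR y p.
Proof.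
move=> x0 y0; have [/andP[p0 p1]] := p01.
have [xy0|xy0] := eqVneq (x + y) 0.
  by rewrite xy0 powR0 ?addr_ge0 ?powR_ge0 // gt_eqF.
have s0 : 0 < x + y by rewrite lt_def xy0 addr_ge0.
have frac z : 0 <= z -> z <= x + y -> z / (x + y) <= powR (z / (x + y)) p.
  move=> z0 zs; have [->|zn0] := eqVneq z 0; first by rewrite mul0r powR_ge0.
  have zp : 0 < z by rewrite lt_def zn0.
  have : 0 < z / (x + y) <= 1 by rewrite divr_gt0 //= ler_pdivrMr // mul1r.
  move=> h; rewrite -[leLHS]powRr1 ?divr_ge0 ?(ltW s0) //.
  by apply: (ger_powR h); exact: ltW.
have xE : powR x p = powR (x / (x + y)) p * powR (x + y) p.
  by rewrite -powRM ?divr_ge0 ?(ltW s0) // mulfVK.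
have yE : powR y p = powR (y / (x + y)) p * powR (x + y) p.
  by rewrite -powRM ?divr_ge0 ?(ltW s0) // mulfVK.
rewrite xE yE -mulrDl ler_peMl ?powR_ge0 //.
rewrite (@le_trans _ _ (x / (x + y) + y / (x + y))) //.
  by rewrite -mulrDl divff.
by apply: lerD; apply: frac => //; rewrite ?lerDl ?lerDr.
Qed.

(** What (G1) says about [theta] along one path, with the pattern of acceptance left arbitrary. *)
Definition gap_trajectory (th : nat -> R) (acc : nat -> bool) : Prop :=
  [/\ th 0%N = theta0, (forall k, 0 <= th k),
    (forall k, acc k -> th k.+1 <= (eta + nu k) * th k + eps k)
  & (forall k, ~~ acc k -> th k.+1 = th k)].

(** Early on [eta + nu k] may exceed 1; this bound, common to all trajectories, covers those
    finitely many steps. The added 1 accounts for rejected steps. *)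
Fixpoint crude_bound k : R :=
  if k is k'.+1 then (1 + eta + nu k') * crude_bound k' + eps k' else theta0.

Let crude_bound_ge0 k : 0 <= crude_bound k.
Proof.
case/andP: eta01 => e0 _.
by elim: k => //= k IH; rewrite addr_ge0 // mulr_ge0 // !addr_ge0 // ltW.
Qed.

Let le_crude_bound th acc k : gap_trajectory th acc -> th k <= crude_bound k.
Proof.
case/andP: eta01 => e0 _.
move=> [th0 th_ge0 thA thN]; elim: k => [|k IH]; first by rewrite th0.
have n0 := nu_ge0 k; have t0 := th_ge0 k; have s0 := eps_ge0 k.
have h : (eta + nu k) * th k <= (1 + eta + nu k) * crude_bound k.
  by rewrite ler_pM ?addr_ge0 ?(ltW e0) // -addrA lerDr.
have h' : th k <= (1 + eta + nu k) * crude_bound k.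
  by rewrite (le_trans IH) // ler_peMl ?crude_bound_ge0 //; lra.
have [/thA|/thN ->] := boolP (acc k); rewrite /=; lra.
Qed.

(* With [a_k = theta_k^p] and [q < 1], an accepted step has
   [(1 - q) a_(k+1) <= q (a_k - a_(k+1)) + eps_k^p], which telescopes. *)
Lemma contraction_powR_sums (S1 S2 : R) :
  (forall N, \sum_(0 <= k < N) nu k <= S1) ->
  (forall N, \sum_(0 <= k < N) powR (eps k) p <= S2) ->
  exists2 B, 0 <= B & forall th acc, gap_trajectory th acc -> forall N,
    powR (th N) p <= B /\ \sum_(0 <= k < N | acc k) powR (th k.+1) p <= B.
Proof.
move=> nuS epsS; case/andP: eta01 => e0 e1; case/andP: p01 => p0 p1.
(* From [K] on the factor [eta + nu k] is at most [(1 + eta) / 2 < 1], the base of [q]. *)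
have [K KP] : exists K, forall k, (K <= k)%N -> nu k <= (1 - eta) / 2.
  by apply: (summable_eventually_le nu_ge0 nuS); rewrite divr_gt0 // subr_gt0.
pose q := powR ((1 + eta) / 2) p.
have q0 : 0 < q by rewrite powR_gt0 // divr_gt0 // addr_gt0.
have q1 : q < 1.
  have -> : 1 = powR 1 p :> R by rewrite powR1.
  by rewrite gt0_ltr_powR ?nnegrE //; lra.
(* Up to index [K] included: it dominates each [th_N^p] with [N <= K] and also the sum of
   [th_(k+1)^p] over accepted [k < K]. *)
pose B1 := \sum_(0 <= k < K.+1) powR (crude_bound k) p.
have B10 : 0 <= B1 by apply: sumr_ge0 => k _; exact: powR_ge0.
have S20 : 0 <= S2 by have := epsS 0%N; rewrite big_nil.
pose C := (1 - q) * B1 + q * B1 + S2.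
have C0 : 0 <= C by rewrite /C -mulrDl subrK mul1r addr_ge0.
have q'0 : 0 < 1 - q by rewrite subr_gt0.
(* [B1] serves the indices up to [K]; later, [(1 - q) s + q a <= C] with both terms nonnegative
   bounds [a] and [s] separately. *)
exists (B1 + C / q + C / (1 - q)).
  by rewrite !addr_ge0 // divr_ge0 // ltW.
move=> th acc tr; have [th0 th_ge0 thA thN] := tr.
have crudep k : powR (th k) p <= powR (crude_bound k) p.
  by rewrite ge0_ler_powR ?(ltW p0) ?nnegrE // (le_crude_bound _ tr).
have early N : (N <= K)%N -> powR (th N) p <= B1.
  move=> NK; rewrite (le_trans (crudep N)) // /B1.
  rewrite big_mkord (bigD1 (Ordinal (NK : (N < K.+1)%N))) //= lerDl.
  by apply: sumr_ge0 => k _; exact: powR_ge0.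
have earlyS N : (N <= K)%N -> \sum_(0 <= k < N | acc k) powR (th k.+1) p <= B1.
  move=> NK; rewrite /B1 big_nat_recl //.
  apply: (@le_trans _ _ (\sum_(0 <= k < K) powR (crude_bound k.+1) p)); last first.
    by rewrite lerDr powR_ge0.
  rewrite [leRHS](big_cat_nat (leq0n _) NK) /= -[leLHS]addr0 lerD //; last first.
    by apply: sumr_ge0 => k _; exact: powR_ge0.
  rewrite big_mkcond; apply: ler_sum => k _; case: (acc k); last exact: powR_ge0.
  exact: crudep.
have late N : (K <= N)%N ->
    (1 - q) * \sum_(0 <= k < N | acc k) powR (th k.+1) p + q * powR (th N) p <=
    (1 - q) * B1 + q * B1 + \sum_(0 <= k < N) powR (eps k) p.
  elim: N => [|N IH] KN.
    rewrite leqn0 in KN; have K0 : (0 <= K)%N by [].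
    rewrite !big_nil mulr0 add0r addr0.
    have := early 0%N K0; move: (ltW q'0) (ltW q0) => h1 h2 h3.
    by rewrite -[leLHS]add0r lerD ?mulr_ge0 // ler_wpM2l.
  move: KN; rewrite leq_eqVlt => /predU1P[KN|].
    rewrite -KN -[leLHS]addr0 lerD //; last first.
      by apply: sumr_ge0 => k _; exact: powR_ge0.
    by rewrite lerD // ler_wpM2l ?(ltW q'0) ?(ltW q0) ?early ?earlyS.
  rewrite ltnS => KN; have {}IH := IH KN.
  rewrite [in leRHS]big_nat_recr //= big_mkcond big_nat_recr //= -big_mkcond /=.
  have ep0 := powR_ge0 (eps N) p.
  case: ifPn => [aN|/thN ->]; last by lra.
  have : powR (th N.+1) p <= q * powR (th N) p + powR (eps N) p.
    have h : th N.+1 <= (1 + eta) / 2 * th N + eps N.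
      rewrite (le_trans (thA _ aN)) // lerD2r ler_wpM2r //.
      by have := KP N KN; lra.
    have h0 : 0 <= (1 + eta) / 2 * th N.
      by rewrite mulr_ge0 // divr_ge0 // addr_ge0 // ltW.
    rewrite /q -powRM ?divr_ge0 ?addr_ge0 ?(ltW e0) //.
    apply: le_trans (powR_subadditive h0 (eps_ge0 N)).
    by rewrite ge0_ler_powR ?(ltW p0) // nnegrE // addr_ge0.
  by move: IH; move: (powR _ _) (powR _ _) (powR _ _) => *; lra.
move=> N; have ep := epsS N; have t0 := powR_ge0 (th N) p.
have Cq : 0 <= C / q by rewrite divr_ge0 // ltW.
have Cq' : 0 <= C / (1 - q) by rewrite divr_ge0 // ltW.
have Sp : 0 <= \sum_(0 <= k < N | acc k) powR (th k.+1) p.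
  by apply: sumr_ge0 => k _; exact: powR_ge0.
have [NK|/ltnW KN] := leqP N K.
  by have := early N NK; have := earlyS N NK; lra.
have := late N KN; move: t0 Sp; set a := powR _ _; set s := \sum_(_ <= _ < _ | _) _.
move=> a0 s0 h; have {ep}h : (1 - q) * s + q * a <= C by rewrite /C; lra.
have qa : 0 <= q * a by rewrite mulr_ge0 // ltW.
have qs : 0 <= (1 - q) * s by rewrite mulr_ge0 // ltW.
have h1 : a <= C / q by rewrite ler_pdivlMr // mulrC; lra.
have h2 : s <= C / (1 - q) by rewrite ler_pdivlMr // mulrC; lra.
lra.
Qed.

(** The bound on [theta^p] gives [theta <= Th = B^(1/p)], so
    [theta_(k+1)^2 <= Th^(2-p) theta_(k+1)^p], and the factor [theta_k^(1-p)] is at most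
    [Th^(1-p)]. *)
Lemma contraction_sums (S1 S2 : R) :
  (forall N, \sum_(0 <= k < N) nu k <= S1) ->
  (forall N, \sum_(0 <= k < N) powR (eps k) p <= S2) ->
  exists2 B, 0 <= B & forall th acc, gap_trajectory th acc -> forall N,
    \sum_(0 <= k < N | acc k) th k.+1 ^+ 2 <= B /\
    \sum_(0 <= k < N | acc k) powR (th k) (1 - p) * powR (th k.+1) p <= B.
Proof.
move=> nuS epsS; have [B B0 BP] := contraction_powR_sums nuS epsS.
case/andP: p01 => p0 p1.
pose Th := powR B p^-1.
have Th0 : 0 <= Th by exact: powR_ge0.
exists (powR Th (2 - p) * B + powR Th (1 - p) * B).
  by rewrite addr_ge0 // mulr_ge0 // powR_ge0.
move=> th acc tr N; have [th0 th_ge0 thA thN] := tr.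
have thTh k : th k <= Th.
  rewrite -[leLHS]powRr1 // -(divff (lt0r_neq0 p0)) powRrM.
  rewrite ge0_ler_powR ?invr_ge0 ?(ltW p0) ?nnegrE ?powR_ge0 //.
  by have [] := BP _ _ tr k.
have [_ SB] := BP _ _ tr N.
have T1 : 0 <= powR Th (2 - p) * B by rewrite mulr_ge0 // powR_ge0.
have T2 : 0 <= powR Th (1 - p) * B by rewrite mulr_ge0 // powR_ge0.
split.
  apply: (@le_trans _ _ (powR Th (2 - p) * B)); last by rewrite lerDl.
  apply: le_trans (ler_wpM2l (powR_ge0 _ _) SB); rewrite mulr_sumr.
  apply: ler_sum => k _; rewrite -powR_mulrn //.
  rewrite -[2%:R in leLHS](subrK p) powRD; last first.
    by rewrite subrK pnatr_eq0.
  by rewrite ler_wpM2r ?powR_ge0 // ge0_ler_powR ?nnegrE //; lra.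
apply: (@le_trans _ _ (powR Th (1 - p) * B)); last by rewrite lerDr.
apply: le_trans (ler_wpM2l (powR_ge0 _ _) SB); rewrite mulr_sumr.
apply: ler_sum => k _; rewrite ler_wpM2r ?powR_ge0 //.
by rewrite ge0_ler_powR ?nnegrE //; lra.
Qed.

End Contraction.

(** * Weighted residual sums along one path *)

Section DescentPath.
Context {R : realType}.
Variables (eta p theta0 beta kappa g c psi0 res0 Ca : R) (nu eps1 eps2 alpha : nat -> R).
Hypotheses (eta01 : 0 < eta < 1) (p01 : 0 < p < 1) (theta0_ge0 : 0 <= theta0).
Hypotheses (nu_ge0 : forall k, 0 <= nu k) (eps1_ge0 : forall k, 0 <= eps1 k).
Hypotheses (eps2_ge0 : forall k, 0 <= eps2 k) (beta_gt0 : 0 < beta) (g_gt0 : 0 < g).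
Hypotheses (kappa_ge0 : 0 <= kappa) (Ca_ge0 : 0 <= Ca).
Hypotheses (alpha01 : forall k, 0 <= alpha k <= 1) (alpha_dec : forall k, alpha k.+1 <= alpha k).

(* [ps], [n2], [e2] and [res] stand for [psi(x^k)], [|F^k|^2], the squared gradient
   error and the squared residual at [x^k] along one sample path. *)
Definition descent_path (th : nat -> R) (acc : nat -> bool) (ps n2 e2 res : nat -> R) : Prop :=
  [/\ gap_trajectory eta theta0 nu eps1 th acc,
      [/\ ps 0%N = psi0, (forall k, c <= ps k),
        (forall k, acc k ->
          ps k.+1 <= ps k + beta * (powR (th k) (1 - p) * powR (th k.+1) p) + eps2 k)
      & (forall k, ~~ acc k ->
          ps k.+1 <= ps k - g * (alpha k * n2 k) + kappa * (alpha k * e2 k))],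
      [/\ (forall k, 0 <= n2 k), (forall k, 0 <= e2 k) & (forall k, 0 <= res k)]
    & [/\ res 0%N = res0,
        (forall k, acc k -> res k.+1 <= Ca * (th k.+1 ^+ 2 + e2 k.+1))
      & (forall k, ~~ acc k -> res k.+1 <= Ca * (n2 k + e2 k))]].

Lemma sum_if_recr (acc : nat -> bool) (F : nat -> R) N :
  \sum_(0 <= k < N.+1 | acc k) F k =
  \sum_(0 <= k < N | acc k) F k + (if acc N then F N else 0).
Proof. by rewrite big_mkcond big_nat_recr //= -big_mkcond. Qed.

(* The residual after a rejected step is paid for by the descent of that step,
   because [alpha] decreases; after an accepted step it is [theta]. *)
Lemma descent_path_sums (S1 S2 S3 : R) :
  (forall N, \sum_(0 <= k < N) nu k <= S1) ->
  (forall N, \sum_(0 <= k < N) powR (eps1 k) p <= S2) ->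
  (forall N, \sum_(0 <= k < N) eps2 k <= S3) ->
  exists C1 C2, [/\ 0 <= C1, 0 <= C2 & forall th acc ps n2 e2 res,
    descent_path th acc ps n2 e2 res -> forall N,
    \sum_(0 <= k < N) alpha k * res k <= C1 + C2 * \sum_(0 <= k < N) alpha k * e2 k].
Proof.
move=> nuS epsS eps2S.
have [B B0 BP] := contraction_sums eta01 p01 theta0_ge0 nu_ge0 eps1_ge0 nuS epsS.
have S30 : 0 <= S3 by have := eps2S 0%N; rewrite big_nil.
(* The total descent available: the initial gap plus all increases that (G2) can grant. The absolute
   value makes it nonnegative before any path is given. *)
pose A0 := `|psi0 - c| + beta * B + S3.
have A00 : 0 <= A0 by rewrite !addr_ge0 // mulr_ge0 // ltW.
have gi : 0 <= g^-1 by rewrite invr_ge0 ltW.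
exists (`|res0| + Ca * (B + A0 / g)), (Ca * (kappa / g + 2)); split.
- by rewrite addr_ge0 // mulr_ge0 // addr_ge0 // mulr_ge0.
- by rewrite mulr_ge0 // addr_ge0 // mulr_ge0.
move=> th acc ps n2 e2 res [tr [ps0 psc psA psN] [n20 e20 res_ge0] [resE resA resN]].
have al0 k : 0 <= alpha k by case/andP: (alpha01 k).
have al1 k : alpha k <= 1 by case/andP: (alpha01 k).
pose E N := \sum_(0 <= k < N) alpha k * e2 k.
pose Rj N := \sum_(0 <= k < N | ~~ acc k) alpha k * n2 k.
pose Th N := \sum_(0 <= k < N | acc k) th k.+1 ^+ 2.
have E0 N : 0 <= E N by apply: sumr_ge0 => k _; rewrite mulr_ge0.
have ES N : E N.+1 = E N + alpha N * e2 N by rewrite /E big_nat_recr.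
have RS N : Rj N.+1 = Rj N + (if ~~ acc N then alpha N * n2 N else 0).
  exact: (sum_if_recr (fun k => ~~ acc k)).
have TS N : Th N.+1 = Th N + (if acc N then th N.+1 ^+ 2 else 0).
  exact: (sum_if_recr acc).
have descent N : ps N + g * Rj N <= psi0 +
    beta * (\sum_(0 <= k < N | acc k) powR (th k) (1 - p) * powR (th k.+1) p) +
    \sum_(0 <= k < N) eps2 k + kappa * E N.
  elim: N => [|N IH].
    by rewrite /Rj /E !big_nil ps0 !mulr0 !addr0.
  rewrite ES RS (sum_if_recr acc) [\sum_(0 <= k < N.+1) eps2 k]big_nat_recr //=.
  have ep := eps2_ge0 N; have ke : 0 <= kappa * (alpha N * e2 N) by rewrite !mulr_ge0.
  by have [/psA|/psN] := boolP (acc N); move: IH; rewrite /=; lra.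
have Rbound N : Rj N <= A0 / g + kappa / g * E N.
  rewrite -(ler_pM2l g_gt0).
  rewrite (_ : g * (_ + _) = A0 + kappa * E N); last first.
    by rewrite mulrDr mulrCA divff ?gt_eqF // mulr1 mulrA mulrCA divff ?gt_eqF // mulr1.
  have [_ pw] := BP _ _ tr N.
  have := ler_wpM2l (ltW beta_gt0) pw; have := descent N; have := eps2S N; have := psc N.
  have := ler_norm (psi0 - c); rewrite /A0; lra.
(* The residual at [k + 1] is charged to the error at [k + 1] after an accepted step and to that at
   [k] after a rejected one. An error can thus enter twice, whence the summand 2 in the second
   constant. *)
have W N : \sum_(0 <= k < N.+1) alpha k * res k <=
    `|res0| + Ca * (Th N + Rj N + E N.+1 + E N).
  elim: N => [|N IH].
    rewrite big_nat1 /Th /Rj /E big_nat1 !big_nil addr0 !add0r resE.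
    apply: (@le_trans _ _ `|res0|); last by rewrite lerDl !mulr_ge0.
    by rewrite (le_trans (ler_norm _)) // normrM ger0_norm // ler_piMl.
  rewrite big_nat_recr //= ES RS TS.
  have tt : 0 <= th N.+1 ^+ 2 by exact: sqr_ge0.
  have aN : 0 <= alpha N * e2 N by rewrite mulr_ge0.
  have an : 0 <= alpha N * n2 N by rewrite mulr_ge0.
  have aN1 : 0 <= alpha N.+1 * e2 N.+1 by rewrite mulr_ge0.
  rewrite !ES in IH *.
  have [aA|aA] := boolP (acc N) => /=.
    have h := ler_wpM2l (al0 N.+1) (resA _ aA).
    have h' : alpha N.+1 * th N.+1 ^+ 2 <= th N.+1 ^+ 2 by rewrite ler_piMl.
    have h'' : alpha N.+1 * res N.+1 <= Ca * (th N.+1 ^+ 2 + alpha N.+1 * e2 N.+1).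
      rewrite (le_trans h) // mulrCA ler_wpM2l // mulrDr lerD2r //.
    by have := mulr_ge0 Ca_ge0 aN; lra.
  have h := ler_wpM2r (res_ge0 N.+1) (alpha_dec N).
  have h' := ler_wpM2l (al0 N) (resN _ aA).
  have := mulr_ge0 Ca_ge0 aN1; have := mulr_ge0 Ca_ge0 aN; lra.
have C20 : 0 <= Ca * (kappa / g + 2) by rewrite mulr_ge0 // addr_ge0 // mulr_ge0.
case=> [|N].
  by rewrite !big_nil mulr0 addr0 addr_ge0 // mulr_ge0 // addr_ge0 // mulr_ge0.
apply: le_trans (W N) _; rewrite -/(E _) -!addrA lerD2l -mulrA -mulrDr ler_wpM2l //.
have [T _] := BP _ _ tr N; have := Rbound N; rewrite -/(Th N) in T.
have aN : 0 <= alpha N * e2 N by rewrite mulr_ge0.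
have kg : 0 <= kappa / g * (alpha N * e2 N) by rewrite !mulr_ge0.
by rewrite ES; lra.
Qed.

End DescentPath.

(** * Convergence of S4N *)

Section WeightedExpectations.
Context d (T : measurableType d) (R : realType) (P : probability T R).
Local Open Scope ereal_scope.

Lemma integral_weighted_sum (a : nat -> R) (Y : nat -> T -> R) N :
  (forall k, 0 <= a k)%R -> (forall k, measurable_fun setT (Y k)) ->
  (forall k w, 0 <= Y k w)%R ->
  \int[P]_w (\sum_(0 <= k < N) a k * Y k w)%R%:E =
  \sum_(0 <= k < N) (a k)%:E * \int[P]_w (Y k w)%:E.
Proof.
move=> a0 mY Y0; under eq_integral do rewrite -sumEFin.
rewrite ge0_integral_sum //.
- apply: eq_bigr => k _; under eq_integral do rewrite EFinM.
  rewrite ge0_integralZl_EFin // => [w _|]; first by rewrite lee_fin.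
  exact/measurable_EFinP.
- by move=> k; apply/measurable_EFinP; apply: measurable_funM.
- by move=> k w _; rewrite lee_fin mulr_ge0.
Qed.

(** [divergent_weights_small] is applied to the means of [y_k^2] and, path by path, to [y_k^2]
    itself; the random series has mean at most [S], hence is finite almost everywhere. *)
Lemma weighted_sum_bounds_liminf (a s : nat -> R) (y Z : nat -> T -> R) (C1 C2 S : R) :
  (forall k, 0 <= a k)%R -> \sum_(0 <= k <oo) (a k)%:E = +oo ->
  (forall k, measurable_fun setT (y k)) -> (forall k w, 0 <= y k w)%R ->
  (forall k, measurable_fun setT (Z k)) -> (forall k w, 0 <= Z k w)%R ->
  (0 <= C1)%R -> (0 <= C2)%R ->
  (forall w N, \sum_(0 <= k < N) a k * y k w ^+ 2 <=
    C1 + C2 * \sum_(0 <= k < N) a k * Z k w)%R ->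
  (forall k, \int[P]_w (Z k w)%:E <= (s k)%:E) ->
  (forall N, \sum_(0 <= k < N) a k * s k <= S)%R ->
  limn_einf (fun k => \int[P]_w (y k w ^+ 2)%:E) = 0 /\
  {ae P, forall w, limn_einf (fun k => (y k w)%:E) = 0}.
Proof.
move=> a0 ainf my y0 mZ Z0 C10 C20 yZ Zs asS.
have my2 k : measurable_fun setT (fun w => y k w ^+ 2)%R by exact: measurable_funX.
have aZ0 N w : (0 <= \sum_(0 <= k < N) a k * Z k w)%R.
  by apply: sumr_ge0 => k _; rewrite mulr_ge0.
have maZ N : measurable_fun setT (fun w => \sum_(0 <= k < N) a k * Z k w)%R.
  by apply: measurable_sum => k; apply: measurable_funM.
have EZ N : \int[P]_w (\sum_(0 <= k < N) a k * Z k w)%R%:E <= S%:E.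
  rewrite integral_weighted_sum //; apply: (@le_trans _ _ (\sum_(0 <= k < N) a k * s k)%:E).
    rewrite -sumEFin; apply: lee_sum => k _.
    by rewrite EFinM lee_wpmul2l ?lee_fin.
  by rewrite lee_fin.
split.
  apply: limn_einf_eq0 => [k|].
    by apply: integral_ge0 => w _; rewrite lee_fin sqr_ge0.
  apply: (divergent_weights_small a0 ainf (C := (C1 + C2 * S)%R)) => [k|N].
    by apply: integral_ge0 => w _; rewrite lee_fin sqr_ge0.
  rewrite -(@integral_weighted_sum a (fun k w => y k w ^+ 2)%R) //; last first.
    by move=> k w; rewrite sqr_ge0.
  apply: (@le_trans _ _
      (\int[P]_w (C1%:E + C2%:E * (\sum_(0 <= k < N) a k * Z k w)%R%:E))).
    apply: ge0_le_integral => //.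
    - by move=> w _; rewrite lee_fin sumr_ge0 // => k _; rewrite mulr_ge0 ?sqr_ge0.
    - by apply/measurable_EFinP; apply: measurable_sum => k; apply: measurable_funM.
    - under eq_fun do rewrite -EFinM -EFinD.
      by apply/measurable_EFinP; apply: measurable_funD => //; apply: measurable_funM.
    - by move=> w _; rewrite -EFinM -EFinD lee_fin.
  rewrite ge0_integralD //; last 2 first.
    - by move=> w _; rewrite mule_ge0 ?lee_fin.
    - under eq_fun do rewrite -EFinM.
      by apply/measurable_EFinP; apply: measurable_funM.
  have -> : \int[P]_w C1%:E = C1%:E.
    have := @integral_cst _ _ _ P setT measurableT C1%:E.
    by rewrite /= probability_setT mule1.
  rewrite ge0_integralZl_EFin //.
  - by rewrite EFinD EFinM leeD2l // lee_wpmul2l ?lee_fin.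
  - by move=> w _; rewrite lee_fin.
  - exact/measurable_EFinP.
pose Zoo w := \sum_(0 <= k <oo) (a k * Z k w)%R%:E.
have aZk0 k w : 0 <= (a k * Z k w)%R%:E by rewrite lee_fin mulr_ge0.
have mk k : measurable_fun setT (fun w => (a k * Z k w)%R%:E).
  by apply/measurable_EFinP; apply: measurable_funM.
have iZ : P.-integrable setT Zoo.
  apply/integrableP; split; first exact: ge0_emeasurable_sum.
  apply: (@le_lt_trans _ _ S%:E); last exact: ltry.
  under eq_integral => w _ do rewrite gee0_abs ?nneseries_ge0 //.
  rewrite integral_nneseries //.
  apply: lime_le; first by apply: is_cvg_nneseries => k _ _; exact: integral_ge0.
  apply: nearW => N; apply: le_trans (EZ N); rewrite integral_weighted_sum //.
  apply: lee_sum => k _; under eq_integral do rewrite EFinM.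
  rewrite ge0_integralZl_EFin // => [w _|]; first by rewrite lee_fin.
  exact/measurable_EFinP.
have := integrable_ae measurableT iZ; apply: filterS => w /(_ I) Zfin.
have small := @divergent_weights_small _ a (fun k => (y k w ^+ 2)%:E)
  (C1 + C2 * fine (Zoo w)) a0 ainf.
apply: limn_einf_eq0 => [k|e N e0]; first by rewrite lee_fin.
(* Tolerance [e^2], because the sums control squares while the claim concerns [y_k]. *)
have [||k Nk yk] := small _ _ (e ^+ 2)%R N (exprn_gt0 2 e0).
- by move=> k; rewrite lee_fin sqr_ge0.
- move=> M; under eq_bigr do rewrite -EFinM.
  rewrite sumEFin lee_fin (le_trans (yZ w M)) // lerD2l ler_wpM2l //.
  rewrite -lee_fin fineK // -sumEFin.
  exact: (nneseries_lim_ge M).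
by exists k => //; move: yk; rewrite !lee_fin ler_sqr ?nnegrE ?y0 ?(ltW e0).
Qed.

End WeightedExpectations.

Section Measurability.
Context d (T : measurableType d) (R : realType).
Implicit Types n : nat.

Lemma measurable_bool_set (A : set T) : measurable A ->
  measurable_fun setT (fun w => `[< A w >]).
Proof.
move=> mA; apply: (measurable_fun_bool true); rewrite setTI.
by rewrite (_ : _ @^-1` _ = A) //; apply/seteqP; split => w /= /asboolP.
Qed.

Lemma mx_measurable_if m n (A : set T) (X Y Z : T -> 'M[R]_(m, n)) : measurable A ->
  mx_measurable X -> mx_measurable Y ->
  (forall w, A w -> Z w = X w) -> (forall w, ~ A w -> Z w = Y w) -> mx_measurable Z.
Proof.
move=> mA mX mY ZX ZY i j.
rewrite (_ : (fun w => Z w i j) = fun w => if `[< A w >] then X w i j else Y w i j).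
  by apply: measurable_fun_ifT; [exact: measurable_bool_set|exact: mX|exact: mY].
by apply/funext => w; case: asboolP => [/ZX|/ZY] ->.
Qed.

Lemma enorm_measurable n (X : T -> 'cV[R]_n) :
  mx_measurable X -> measurable_fun setT (fun w => enorm (X w)).
Proof. by move=> mX; apply: continuous_mx_measurable mX (@enorm_continuous _ _). Qed.

Lemma Gavg_measurable dX (Xi : measurableType dX) n (G : 'cV[R]_n -> Xi -> 'cV[R]_n)
    m (s : 'I_m -> T -> Xi) (X : T -> 'cV[R]_n) :
  (forall v, continuous (fun z => G z v)) ->
  (forall z i j, measurable_fun setT (fun v => G z v i j)) ->
  (forall i, measurable_fun setT (s i)) -> mx_measurable X ->
  mx_measurable (fun w => Gavg G (fun i => s i w) (X w)).
Proof.
move=> cG mG ms mX; apply: mx_measurableZ; apply: mx_measurable_sum => k.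
exact: (measurable_caratheodory_comp cG mG mX (ms k)).
Qed.

Lemma FL_measurable n (r : 'cV[R]_n -> \bar R) L lo hi (g X : T -> 'cV[R]_n) :
  econvex r -> lower_semicontinuous r -> proper_fun r -> quad_bounds L lo hi ->
  mx_measurable g -> mx_measurable X -> mx_measurable (fun w => FL L r (g w) (X w)).
Proof.
move=> rc rl rp qL mg mX; apply: mx_measurableB => //.
apply: (mx_measurable_comp _ (prox_continuous rc rl rp qL)).
apply: mx_measurableB => //; apply: mx_measurableM => //; exact: mx_measurable_cst.
Qed.

Lemma psi_measurable n f (r : 'cV[R]_n -> \bar R) (X : T -> 'cV[R]_n) :
  continuous f -> lower_semicontinuous r -> proper_fun r -> mx_measurable X ->
  measurable_fun setT (fun w => psi f r (X w)).
Proof.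
move=> cf rl rp mX; apply: (@lsc_mx_measurable _ _ _ _ _ X (psi f r)) => //.
have := lsc_add_continuous rl rp.1 cf.
by rewrite (_ : (fun x => _) = psi f r) //; apply/funext => x; rewrite addeC.
Qed.

End Measurability.

Theorem theorem3p6
  (R : realType) (n : nat)
  (d : measure_display) (T : measurableType d) (P : probability T R)
  (dX : measure_display) (Xi : measurableType dX)
  (f : 'cV[R]_n -> R) (gradf : 'cV[R]_n -> 'cV[R]_n) (r : 'cV[R]_n -> \bar R)
  (Gc : 'cV[R]_n -> Xi -> 'cV[R]_n) (Hc : 'cV[R]_n -> Xi -> 'M[R]_n)
  (ng nh : nat -> nat)
  (s : forall k, 'I_(ng k) -> T -> Xi) (t : forall k, 'I_(nh k) -> T -> Xi)
  (Lam : nat -> 'M[R]_n)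
  (alpha nu eps1 eps2 sigma : nat -> R)
  (eta p beta theta0 L lm lM gamma rho : R) (x0 : 'cV[R]_n)
  (x : nat -> T -> 'cV[R]_n) (theta : nat -> T -> R) (M : nat -> T -> 'M[R]_n)
  (* standing assumptions on f and r *)
  (Hgrad : is_gradient f gradf) (Hgradc : continuous gradf)
  (Hrconv : econvex r) (Hrlsc : lower_semicontinuous r) (Hrprop : proper_fun r)
  (* Caratheodory functions G and H *)
  (HGc : forall xi, continuous (fun z => Gc z xi))
  (HGm : forall z i j, measurable_fun setT (fun xi => Gc z xi i j))
  (HHsym : forall z xi, (Hc z xi)^T = Hc z xi)
  (HHc : forall xi, continuous (fun z => Hc z xi))
  (HHm : forall z i j, measurable_fun setT (fun xi => Hc z xi i j))
  (* mini-batches of random samples *)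
  (Hng : forall k, (0 < ng k)%N) (Hnh : forall k, (0 < nh k)%N)
  (Hsm : forall k i, measurable_fun setT (s k i))
  (Htm : forall k i, measurable_fun setT (t k i))
  (* parameters of S4N *)
  (Hx0 : edom r x0) (Htheta0 : 0 <= theta0)
  (HLam : forall k, is_spd (Lam k))
  (Heta : 0 < eta < 1) (Hp : 0 < p < 1) (Hbeta : 0 < beta)
  (Hnu0 : forall k, 0 <= nu k) (Heps10 : forall k, 0 <= eps1 k) (Heps20 : forall k, 0 <= eps2 k)
  (* the iterates are generated by S4N *)
  (Hinit : forall w, x 0%N w = x0 /\ theta 0%N w = theta0)
  (Hsel : forall k w,
     Mset (Lam k) r (Gavg Gc (fun i => s k i w) (x k w))
                    (Havg Hc (fun j => t k j w) (x k w)) (x k w) (M k w))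
  (Hstep : forall k w,
     let Fk := FL (Lam k) r (Gavg Gc (fun i => s k i w) (x k w)) (x k w) in
     let zn := x k w + - (mpinv (M k w) *m Fk) in
     let zp := x k w - alpha k *: Fk in
     let Fn := enorm (FL (Lam k.+1) r (Gavg Gc (fun i => s k.+1 i w) zn) zn) in
     let accept := edom r zn /\
                   Fn <= (eta + nu k) * theta k w + eps1 k /\
                   (psi f r zn <= psi f r (x k w) +
                      (beta * powR (theta k w) (1 - p) * powR Fn p + eps2 k)%:E)%E in
     (accept -> x k.+1 w = zn /\ theta k.+1 w = Fn) /\
     (~ accept -> x k.+1 w = zp /\ theta k.+1 w = theta k w))
  (* (A.1) *)
  (HL : 0 < L) (HLip : forall y z, enorm (gradf y - gradf z) <= L * enorm (y - z))
  (* (A.2) *)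
  (Hbdd : exists c : R, forall y, edom r y -> (c%:E <= psi f r y)%E)
  (* (B.1) *)
  (Hlm : 0 < lm) (HlmM : lm <= lM)
  (HLamb : forall k, loewner_le (lm%:M) (Lam k) /\ loewner_le (Lam k) (lM%:M))
  (* (B.2) *)
  (Hnu : (\sum_(0 <= k <oo) (nu k)%:E < +oo)%E)
  (Heps2 : (\sum_(0 <= k <oo) (eps2 k)%:E < +oo)%E)
  (Heps1 : (\sum_(0 <= k <oo) (powR (eps1 k) p)%:E < +oo)%E)
  (* (C.1) *)
  (HMmeas : forall k (i j : 'I_n) (B : set R), measurable B ->
     filtr s t k ((fun w => M k w i j) @^-1` B))
  (* (C.2) *)
  (Hsig0 : forall k, 0 <= sigma k)
  (Hsig : forall k,
     (\int[P]_w ((enorm (gradf (x k w) - Gavg Gc (fun i => s k i w) (x k w))) ^+ 2)%:E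
        <= (sigma k ^+ 2)%:E)%E)
  (* step sizes *)
  (Halpha01 : forall k, 0 <= alpha k <= 1)
  (Hgamma : 0 < gamma < 1) (Hrho : 1 < rho < gamma^-1)
  (Hdescent : forall k w,
     let v := - FL (Lam k) r (Gavg Gc (fun i => s k i w) (x k w)) (x k w) in
     (psi f r (x k w + alpha k *: v) <= psi f r (x k w) +
        (- (alpha k * gamma * lnorm (Lam k) v ^+ 2)
         + alpha k / (4 * gamma * (rho - 1) * lm)
           * enorm (gradf (x k w) - Gavg Gc (fun i => s k i w) (x k w)) ^+ 2)%:E)%E)
  (Halpha_mono : forall k, alpha k.+1 <= alpha k)
  (Halpha_div : (\sum_(0 <= k <oo) (alpha k)%:E = +oo)%E)
  (Halpha_sig : (\sum_(0 <= k <oo) (alpha k * sigma k ^+ 2)%:E < +oo)%E) :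
  forall Lam' : 'M[R]_n, is_spd Lam' ->
    limn_einf (fun k => (\int[P]_w ((enorm (FL Lam' r (gradf (x k w)) (x k w))) ^+ 2)%:E)%E) = 0%E /\
    {ae P, forall w, limn_einf (fun k => (enorm (FL Lam' r (gradf (x k w)) (x k w)))%:E) = 0%E}.
Proof.
move=> Lam' spdLam'.
have [lo' [hi' q']] := spd_quad_bounds spdLam'.
have qk k : quad_bounds (Lam k) lm lM.
  by have [h1 h2] := HLamb k; exact: loewner_quad_bounds.
have cf : continuous f.
  by move=> z; have [df _] := Hgrad z; exact: differentiable_continuous.
pose g k w := Gavg Gc (fun i => s k i w) (x k w).
pose F k w := FL (Lam k) r (g k w) (x k w).
pose zn k w := x k w + - (mpinv (M k w) *m F k w).
pose Fn k w := FL (Lam k.+1) r (Gavg Gc (fun i => s k.+1 i w) (zn k w)) (zn k w).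
pose accept k : set T := [set w | edom r (zn k w) /\
  enorm (Fn k w) <= (eta + nu k) * theta k w + eps1 k /\
  (psi f r (zn k w) <= psi f r (x k w) +
    (beta * powR (theta k w) (1 - p) * powR (enorm (Fn k w)) p + eps2 k)%:E)%E].
have xA k w : accept k w -> x k.+1 w = zn k w /\ theta k.+1 w = enorm (Fn k w).
  by have [h _] := Hstep k w.
have xN k w : ~ accept k w -> x k.+1 w = x k w - alpha k *: F k w /\
    theta k.+1 w = theta k w.
  by have [_ h] := Hstep k w.
have mM k : mx_measurable (M k).
  move=> i j _ B mB; rewrite setTI; have := HMmeas k i j B mB.
  apply: smallest_sub; first exact: sigma_algebra_measurable.
  move=> A [j' [_ [[i' [B' [mB' ->]]]|[i' [B' [mB' ->]]]]]] /=.
    by rewrite -[X in measurable X]setTI; exact: Hsm.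
  by rewrite -[X in measurable X]setTI; exact: Htm.
(* Joint induction: acceptance at [k] involves [theta k], and its event must be measurable before
   the two candidate iterates are glued. *)
have mxt k : mx_measurable (x k) /\ measurable_fun setT (theta k).
  elim: k => [|k [mx mt]].
    rewrite (_ : x 0%N = fun=> x0); last by apply/funext => w; case: (Hinit w).
    rewrite (_ : theta 0%N = fun=> theta0); last by apply/funext => w; case: (Hinit w).
    by split; [exact: mx_measurable_cst|exact: measurable_cst].
  have mg : mx_measurable (g k) by exact: Gavg_measurable.
  have mF : mx_measurable (F k) by exact: FL_measurable (qk k) mg mx.
  have mz : mx_measurable (zn k).
    apply: mx_measurableD => //; apply: mx_measurableN; apply: mx_measurableM => //.
    exact: mx_measurable_mpinv.
  have mFn : mx_measurable (Fn k).
    by apply: (FL_measurable _ _ _ (qk k.+1)) => //; exact: Gavg_measurable.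
  have mN : measurable_fun setT (fun w => enorm (Fn k w)) by exact: enorm_measurable.
  have mpow (h : T -> R) e : measurable_fun setT h ->
      measurable_fun setT (fun w => powR (h w) e).
    by move=> mh; exact: (measurableT_comp (measurable_powR e) mh).
  have mA : measurable (accept k).
    rewrite (_ : accept k = [set w | (r (zn k w) < +oo)%E] `&`
      ([set w | ((enorm (Fn k w))%:E <= ((eta + nu k) * theta k w + eps1 k)%:E)%E] `&`
       [set w | (psi f r (zn k w) <= psi f r (x k w) +
    (beta * powR (theta k w) (1 - p) * powR (enorm (Fn k w)) p + eps2 k)%:E)%E])) //.
    apply: measurableI; last apply: measurableI.
    - rewrite -[X in measurable X]setTI; apply: emeasurable_fun_infty_o => //.
      exact: lsc_mx_measurable.
    - rewrite -[X in measurable X]setTI; apply: measurable_lee => //.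
        exact/measurable_EFinP.
      apply/measurable_EFinP; apply: measurable_funD => //.
      exact: measurable_funM.
    - rewrite -[X in measurable X]setTI; apply: measurable_lee => //.
        exact: psi_measurable.
      apply: emeasurable_funD; first exact: psi_measurable.
      apply/measurable_EFinP; apply: measurable_funD => //.
      apply: measurable_funM; last exact: mpow.
      by apply: measurable_funM => //; exact: mpow.
  split.
    apply: (mx_measurable_if mA mz (Y := fun w => x k w - alpha k *: F k w)).
    - by apply: mx_measurableB => //; exact: mx_measurableZ.
    - by move=> w /xA [].
    - by move=> w /xN [].
  rewrite (_ : theta k.+1 = fun w => if `[< accept k w >] then enorm (Fn k w) else theta k w).
    by apply: measurable_fun_ifT => //; exact: measurable_bool_set.
  by apply/funext => w; case: asboolP => [/xA|/xN] [].
have mg k : mx_measurable (g k) by apply: Gavg_measurable => //; have [] := mxt k.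
have mgr k : mx_measurable (fun w => gradf (x k w)).
  by apply: (mx_measurable_comp _ Hgradc); have [] := mxt k.
pose Z k w := enorm (gradf (x k w) - g k w) ^+ 2.
pose y k w := enorm (FL Lam' r (gradf (x k w)) (x k w)).
have mZ k : measurable_fun setT (Z k).
  by apply: measurable_funX; apply: enorm_measurable; exact: mx_measurableB.
have my k : measurable_fun setT (y k).
  by apply: enorm_measurable; apply: (FL_measurable _ _ _ q') => //; have [] := mxt k.
(* After a rejected step this rests on the descent hypothesis, whose right-hand side is finite. *)
have dom k w : edom r (x k w).
  elim: k => [|k IH]; first by have [-> _] := Hinit w.
  have [ac|nac] := pselect (accept k w); first by have [-> _] := xA _ _ ac; case: ac.
  have [-> _] := xN _ _ nac; have := Hdescent k w; rewrite /= scalerN -/(g k w) -/(F k w).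
  rewrite /psi (edom_fineK Hrprop IH) -!EFinD /edom /=.
  by case: (r (x k w - alpha k *: F k w)) => [a| |] //=; rewrite ltry.
have psiE z : edom r z -> psi f r z = (fine (psi f r z))%:E.
  by move=> dz; rewrite /psi (edom_fineK Hrprop dz) -EFinD.
have [c psi_ge] := Hbdd.
have [/andP[g0 g1] /andP[rho1 _]] := conj Hgamma Hrho.
have [S1 S10 nuS] := nneseries_bounded Hnu0 Hnu.
have [S2 S20 eps1S] := nneseries_bounded (fun k => powR_ge0 (eps1 k) p) Heps1.
have [S3 S30 eps2S] := nneseries_bounded Heps20 Heps2.
have al0 k : 0 <= alpha k by case/andP: (Halpha01 k).
have [S4 S40 sigS] := nneseries_bounded (fun k => mulr_ge0 (al0 k) (sqr_ge0 (sigma k))) Halpha_sig.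
have L1 : 1 <= 2 + L by rewrite (@le_trans _ _ 2) ?ler1n // lerDl ltW.
pose C := 1 + 2 * (1 + `|hi'| + `|lM|) / lo'.
have C0 : 0 <= C.
  have [_ lo'0 _ _] := q'.
  by rewrite addr_ge0 // divr_ge0 ?(ltW lo'0) // mulr_ge0 // !addr_ge0.
(* [C] compares the metric [Lam'] with every [Lam k] at once. In a rejected step the residual, the
   displacement and the drift of the gradient cost [1 + 1 + L] times [|F^k|]; the outer 2 comes from
   squaring a sum of two terms. *)
pose Ca := 2 * (C * (2 + L)) ^+ 2.
have Ca0 : 0 <= Ca by rewrite mulr_ge0 // sqr_ge0.
have CaP a b e : 0 <= a -> a <= C * (2 + L) * (b + e) -> a ^+ 2 <= Ca * (b ^+ 2 + e ^+ 2).
  move=> a0; rewrite mulrDr => h; apply: le_trans (sqr_le_sum a0 h) _.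
  by rewrite /Ca !exprMn; lra.
pose kappa := (4 * gamma * (rho - 1) * lm)^-1.
have kappa0 : 0 <= kappa.
  by rewrite invr_ge0 !mulr_ge0 // ?subr_ge0 ltW.
have glm0 : 0 < gamma * lm by rewrite mulr_gt0.
(* Obtained before a path [w] is fixed, so [C1] and [C2] are deterministic. The rate [gamma * lm]
   passes from the norm of [Lam k] to the Euclidean one. *)
have [C1 [C2 [C10 C20 HC]]] := descent_path_sums (beta := beta) (kappa := kappa)
  (g := gamma * lm) c (fine (psi f r x0)) (enorm (FL Lam' r (gradf x0) x0) ^+ 2) (Ca := Ca)
  Heta Hp Htheta0 Hnu0 Heps10 Heps20 Hbeta glm0 kappa0 Ca0 Halpha01 Halpha_mono
  nuS eps1S eps2S.
apply: (@weighted_sum_bounds_liminf _ _ _ P alpha (fun k => sigma k ^+ 2) y Z C1 C2 S4) => //.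
- by move=> k w; exact: enorm_ge0.
- by move=> k w; exact: sqr_ge0.
move=> w N; apply: (HC (theta ^~ w) (fun k => `[< accept k w >])
  (fun k => fine (psi f r (x k w))) (fun k => enorm (F k w) ^+ 2) (Z ^~ w)
  (fun k => y k w ^+ 2)).
have [x0E th0E] := Hinit w.
have th_ge0 k : 0 <= theta k w.
  elim: k => [|k IH]; first by rewrite th0E.
  by have [/xA[_ ->]|/xN[_ ->]] := pselect (accept k w); rewrite ?enorm_ge0.
split.
- split=> // k; first by move=> /asboolP ac; have [_ ->] := xA _ _ ac; case: ac => _ [].
  by move=> /asboolPn /xN [].
- split; first by rewrite x0E.
  + by move=> k; rewrite -lee_fin -psiE // psi_ge.
  + move=> k /asboolP ac; have [-> ->] := xA _ _ ac; have [dz [_ h]] := ac.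
    rewrite (psiE _ dz) (psiE _ (dom k w)) -EFinD lee_fin in h.
    by rewrite mulrA -addrA.
  + move=> k /asboolPn nac; have := Hdescent k w; have := dom k.+1 w.
    have [-> _] := xN _ _ nac; rewrite /= scalerN -/(g k w) -/(F k w) => dz.
    rewrite (psiE _ dz) (psiE _ (dom k w)) -EFinD lee_fin => /le_trans; apply.
    rewrite -addrA lerD2l -/(Z k w) [alpha k / _ * _]mulrAC.
    rewrite -[alpha k * Z k w / _]/(alpha k * Z k w * kappa) [_ * kappa]mulrC lerD2r.
    have [_ _ h _] := qk k; rewrite lnorm_sqr; last first.
      by move=> v; apply: le_trans (h v); rewrite mulr_ge0 ?dotv_ge0 // ltW.
    have := h (- F k w); rewrite -enorm_sqr enormN => {}h.
    have := ler_wpM2l (mulr_ge0 (al0 k) (ltW g0)) h.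
    by move: (dotv _ _) (enorm _ ^+ 2); clear => *; lra.
- by split => k; exact: sqr_ge0.
- split; first by rewrite /y x0E.
  (* Both residuals sit at the point [x k.+1], with the mini-batch [k + 1] that (G1) already used,
     so the displacement term vanishes. *)
  + move=> k /asboolP ac; have [xE ->] := xA _ _ ac.
    rewrite /Z; apply: CaP; first exact: enorm_ge0.
    have FnE : FL (Lam k.+1) r (g k.+1 w) (x k.+1 w) = Fn k w by rewrite /g xE.
    have := FL_compare Hrconv Hrlsc Hrprop (gradf (x k.+1 w)) (g k.+1 w)
      (x k.+1 w) (x k.+1 w) q' (qk k.+1).
    rewrite subrr enorm0 addr0 -/C FnE => /le_trans; apply.
    have := enorm_ge0 (gradf (x k.+1 w) - g k.+1 w); have := enorm_ge0 (Fn k w).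
    move: (enorm (Fn k w)) (enorm (gradf (x k.+1 w) - g k.+1 w)) C0 L1.
    clear => a b C0 L1 a0 b0.
    by rewrite -mulrA ler_wpM2l // ler_peMl // addr_ge0.
  (* Here the residual at [x k.+1] is compared with [F k] at the previous point and the old
     mini-batch; [alpha k <= 1] bounds the displacement by [|F k|]. *)
  + move=> k /asboolPn nac; have [xE _] := xN _ _ nac.
    rewrite /Z; apply: CaP; first exact: enorm_ge0.
    have := FL_compare Hrconv Hrlsc Hrprop (gradf (x k.+1 w)) (g k w)
      (x k.+1 w) (x k w) q' (qk k).
    rewrite -/C -/(F k w) => /le_trans; apply.
    rewrite -mulrA ler_wpM2l //.
    have dx : enorm (x k.+1 w - x k w) <= enorm (F k w).
      rewrite xE addrAC subrr add0r enormN enormZ ger0_norm // ler_piMl ?enorm_ge0 //.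
      by case/andP: (Halpha01 k).
    have dg : enorm (gradf (x k.+1 w) - g k w) <=
        L * enorm (F k w) + enorm (gradf (x k w) - g k w).
      rewrite -[gradf (x k.+1 w)](subrK (gradf (x k w))) -addrA.
      rewrite (le_trans (enormD _ _)) // lerD2r (le_trans (HLip _ _)) //.
      by rewrite ler_wpM2l // ltW.
    have e0 := enorm_ge0 (gradf (x k w) - g k w).
    have Le : 0 <= L * enorm (gradf (x k w) - g k w) by rewrite mulr_ge0 // ltW.
    move: (enorm (F k w)) (enorm (gradf (x k w) - g k w))
      (enorm (gradf _ - g k w)) (enorm (x k.+1 w - _)) dx dg e0 Le.
    by clear => *; lra.
Qed.
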